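(* Consider the Euclidean space $\mathbb{R}^n$ with Lebesgue measure $\mu$. Fix $\alpha\in(0,1)$, assume $n>2\alpha$, let $\gamma>-2\alpha$ be a fixed parameter and let $q>1$. Then there is a lower semi-continuous function $u:\mathbb{R}^n\to(0,+\infty)$ which is a super-solution to $(-\Delta)^\alpha u=|x|^\gamma u^q$ in $\mathbb{R}^n$ in the sense that $$u(x)\ge\int_{\mathbb{R}^n}G^{(\alpha)}(x,y)\,u^q(y)\,|y|^\gamma\,d\mu(y)\qquad\text{for all }x\in\mathbb{R}^n,$$ if and only if $$q>\frac{n+\gamma}{n-2\alpha}.$$
   Context: $G^{(\alpha)}$ is the Green kernel of the fractional Laplacian $(-\Delta)^\alpha$ on $\mathbb{R}^n$: $$G^{(\alpha)}(x,y)=\frac1{\Gamma(\alpha)}\int_0^\infty s^{\alpha-1}p_s(x,y)\,ds,\qquad p_s(x,y)=(4\pi s)^{-n/2}e^{-|x-y|^2/(4s)},$$ where $p_s$ is the heat kernel of the Laplacian $\Delta$ on $\mathbb{R}^n$. *)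

(* Defs.v *)
From HB Require Import structures.
From mathcomp Require Import all_boot all_order all_algebra.
From mathcomp Require Import all_classical all_reals all_analysis.
Set Implicit Arguments.
Unset Strict Implicit.
Unset Printing Implicit Defensive.
Import Order.TTheory GRing.Theory Num.Theory.
Import numFieldNormedType.Exports.
Local Open Scope classical_set_scope.
Local Open Scope ring_scope.

(* Row vectors carry the sigma-algebra generated by the coordinate maps, which
   for R is the Borel sigma-algebra of R^n. *)
Section measurable_rV.
Context {d} {T : measurableType d} (n : nat).

Definition rV_coord (i : 'I_n) (v : 'rV[T]_n) : T := v ord0 i.

Let rV_set0 : g_sigma_preimage rV_coord set0.
Proof. exact: sigma_algebra0. Qed.

Let rV_setC A : g_sigma_preimage rV_coord A -> g_sigma_preimage rV_coord (~` A).
Proof. exact: sigma_algebraC. Qed.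

Let rV_bigcup (F : (set 'rV[T]_n)^nat) :
  (forall i, g_sigma_preimage rV_coord (F i)) ->
  g_sigma_preimage rV_coord (\bigcup_i F i).
Proof. exact: sigma_algebra_bigcup. Qed.

HB.instance Definition _ := @isMeasurable.Build (measure_tuple_display d)
  'rV[T]_n (g_sigma_preimage rV_coord) rV_set0 rV_setC rV_bigcup.
End measurable_rV.

Section measurable_fun_rV.
Context d1 d2 (T1 : measurableType d1) (T2 : measurableType d2) (n : nat).

Lemma measurable_fun_rVP (f : T1 -> 'rV[T2]_n) :
  measurable_fun setT f <-> forall i, measurable_fun setT (fun x => f x ord0 i).
Proof.
apply: (@iff_trans _ (g_sigma_preimage
    (fun i => @rV_coord _ T2 n i \o f) `<=` measurable)).
  rewrite g_sigma_preimage_comp; split=> [mf A [/= C preC <-]|prefS].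
    exact: mf.
  by move=> _ A mA; apply: prefS; exists A.
split=> [coordfS i|mf].
- move=> _ A mA.
  apply: coordfS; apply: sub_sigma_algebra.
  case: n i => [[] []//|m i] in f *.
  rewrite -bigcup_mkord_ord.
  exists i; first exact: ltn_ord.
  by exists A => //; rewrite inord_val.
- apply: smallest_sub; first exact: sigma_algebra_measurable.
  case: n => [|m] in f mf *; first by rewrite big_ord0.
  rewrite -bigcup_mkord_ord; apply: bigcup_sub => i Ii.
  by move=> A [B mB <-]; exact: mf.
Qed.

End measurable_fun_rV.

Lemma measurable_rV_coord d (T : measurableType d) n (i : 'I_n) :
  measurable_fun setT (fun v : 'rV[T]_n => v ord0 i).
Proof. by move: i; apply/measurable_fun_rVP. Qed.

Section ex_sigma_finite_measure.
Context d (T : measurableType d) (R : realType) (f : set T -> \bar R).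
Hypotheses (f0 : f set0 = 0%E) (f_ge0 : forall A, (0 <= f A)%E).
Hypotheses (f_sigma_additive : semi_sigma_additive f).
Hypotheses (f_sigma_finite : sigma_finite setT f).

Let g := f.
#[local] HB.instance Definition _ :=
  isMeasure.Build _ _ _ g f0 f_ge0 f_sigma_additive.
#[local] HB.instance Definition _ :=
  Measure_isSigmaFinite.Build _ _ _ g f_sigma_finite.

Lemma ex_sigma_finite_measure :
  exists m : {sigma_finite_measure set T -> \bar R}, m = f :> (set T -> \bar R).
Proof. by exists g. Qed.

End ex_sigma_finite_measure.

Section lebesgue_measure_rV.
Context {R : realType}.

Definition rV_cons n (p : R * 'rV[R]_n) : 'rV[R]_n.+1 :=
  row_mx (p.1)%:M p.2 : 'rV[R]_(1 + n).

(* Lebesgue measure on R^n: the n-fold product of the Lebesgue measure of R.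
   It is characterized by its value on boxes, see lebesgue_rV_box below. *)
Fixpoint lebesgue_rV (n : nat) : set 'rV[R]_n -> \bar R :=
  match n with
  | 0 => \d_(0 : 'rV[R]_0)
  | n.+1 => pushforward (lebesgue_measure \x @lebesgue_rV n)%E (@rV_cons n)
  end.

Lemma rV_cons0 n (p : R * 'rV[R]_n) : rV_cons p ord0 ord0 = p.1.
Proof.
have e : ord0 = lshift n (ord0 : 'I_1) by exact: val_inj.
rewrite /rV_cons; transitivity (row_mx p.1%:M p.2 ord0 (lshift n (ord0 : 'I_1))).
  by congr fun_of_matrix.
by rewrite row_mxEl mxE mulr1n.
Qed.

Lemma rV_consS n (p : R * 'rV[R]_n) (i : 'I_n) :
  rV_cons p ord0 (lift ord0 i) = p.2 ord0 i.
Proof.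
have e : lift ord0 i = rshift 1 i by exact: val_inj.
rewrite /rV_cons; transitivity (row_mx p.1%:M p.2 ord0 (rshift 1 i)).
  by congr fun_of_matrix.
by rewrite row_mxEr.
Qed.

Lemma measurable_rV_cons n : measurable_fun setT (@rV_cons n).
Proof.
apply/measurable_fun_rVP => i; case: (unliftP ord0 i) => [j|] ->.
  under eq_fun do rewrite rV_consS.
  apply: (measurableT_comp (measurable_rV_coord j)).
  exact: measurable_snd.
under eq_fun do rewrite rV_cons0.
exact: measurable_fst.
Qed.

Definition rV_uncons n (v : 'rV[R]_n.+1) : R * 'rV[R]_n :=
  (v ord0 ord0, \row_i v ord0 (lift ord0 i)).

Lemma rV_consK n : cancel (@rV_cons n) (@rV_uncons n).
Proof.
case=> x v; congr pair; first by rewrite rV_cons0.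
by apply/rowP => i; rewrite mxE rV_consS.
Qed.

Lemma rV_unconsK n : cancel (@rV_uncons n) (@rV_cons n).
Proof.
move=> v; apply/rowP => i; case: (unliftP ord0 i) => [j|] ->.
  by rewrite rV_consS mxE.
by rewrite rV_cons0.
Qed.

Lemma measurable_rV_uncons n : measurable_fun setT (@rV_uncons n).
Proof.
apply/measurable_fun_pairP; split; first exact: measurable_rV_coord.
apply/measurable_fun_rVP => i.
rewrite [X in measurable_fun _ X](_ : _ = fun v : 'rV[R]_n.+1 => v ord0 (lift ord0 i)).
  exact: measurable_rV_coord.
by apply/funext => v /=; rewrite mxE.
Qed.

Let lebesgue_rV_sigma_finite_measure n :
  exists m : {sigma_finite_measure set 'rV[R]_n -> \bar R},
    m = @lebesgue_rV n :> (set 'rV[R]_n -> \bar R).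
Proof.
elim: n => [|n [m mE]]; first by exists \d_(0 : 'rV[R]_0).
pose lm : {measure set (measurableTypeR R * 'rV[R]_n)%type -> \bar R} :=
  (@lebesgue_measure R \x m)%E.
pose pm (A : set 'rV[R]_n.+1) := lm (@rV_cons n @^-1` A).
have mcons A : measurable A -> measurable (@rV_cons n @^-1` A).
  by move=> mA; rewrite -[X in measurable X]setTI; exact: measurable_rV_cons.
have pm0 : pm set0 = 0%E by rewrite /pm preimage_set0 measure0.
have pm_ge0 A : (0 <= pm A)%E by exact: (measure_ge0 lm).
have pm_sigma_additive : semi_sigma_additive pm.
  move=> F mF tF mUF; rewrite /pm preimage_bigcup.
  apply: measure_semi_sigma_additive.
  - by move=> k; exact: mcons.
  - apply/trivIsetP => /= i j _ _ ij; rewrite -preimage_setI.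
    by move/trivIsetP : tF => /(_ _ _ _ _ ij) ->//; rewrite preimage_set0.
  - by rewrite -preimage_bigcup; exact: mcons.
have pm_sigma_finite : sigma_finite setT pm.
  have /sigma_finiteP[F [FT ndF Foo]] := sigma_finiteT (@lebesgue_measure R).
  have /sigma_finiteP[G [GT ndG Goo]] := sigma_finiteT m.
  exists (fun k => @rV_uncons n @^-1` (F k `*` G k)).
    rewrite -preimage_bigcup (_ : \bigcup_k _ = setT) ?preimage_setT//.
    apply/seteqP; split => // -[x v] _.
    have [i _ Fix] : (\bigcup_k F k) x by rewrite -FT.
    have [j _ Gjv] : (\bigcup_k G k) v by rewrite -GT.
    exists (maxn i j) => //; split.
    - by move: x Fix; exact/subsetPset/ndF/leq_maxl.
    - by move: v Gjv; exact/subsetPset/ndG/leq_maxr.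
  move=> k; have [mF Fk] := Foo k; have [mG Gk] := Goo k; split.
    rewrite -[X in measurable X]setTI; apply: measurable_rV_uncons => //.
    exact: measurableX.
  rewrite /pm -comp_preimage (_ : _ \o _ = id); last first.
    by apply/funext => p /=; rewrite rV_consK.
  rewrite preimage_id.
  by rewrite /lm /= product_measure1E// lte_mul_pinfty// ge0_fin_numE.
have [m' m'E] := ex_sigma_finite_measure pm0 pm_ge0 pm_sigma_additive pm_sigma_finite.
by exists m'; rewrite m'E /pm /lm /= mE.
Qed.

Section instances.
Variable n : nat.

Let lebesgue_rV0 : @lebesgue_rV n set0 = 0%E.
Proof.
by have [m <-] := lebesgue_rV_sigma_finite_measure n; exact: measure0.
Qed.

Let lebesgue_rV_ge0 A : (0 <= @lebesgue_rV n A)%E.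
Proof.
by have [m <-] := lebesgue_rV_sigma_finite_measure n; exact: measure_ge0.
Qed.

Let lebesgue_rV_sigma_additive : semi_sigma_additive (@lebesgue_rV n).
Proof.
have [m <-] := lebesgue_rV_sigma_finite_measure n.
exact: measure_semi_sigma_additive.
Qed.

HB.instance Definition _ := isMeasure.Build _ _ _ (@lebesgue_rV n)
  lebesgue_rV0 lebesgue_rV_ge0 lebesgue_rV_sigma_additive.

Let lebesgue_rV_sigma_finite : sigma_finite setT (@lebesgue_rV n).
Proof.
by have [m <-] := lebesgue_rV_sigma_finite_measure n; exact: sigma_finiteT.
Qed.

HB.instance Definition _ := Measure_isSigmaFinite.Build _ _ _ (@lebesgue_rV n)
  lebesgue_rV_sigma_finite.

End instances.

Lemma lebesgue_rV_box n (A : 'I_n -> set R) :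
  (forall i, measurable (A i)) ->
  lebesgue_rV [set v : 'rV[R]_n | forall i, A i (v ord0 i)] =
  (\prod_(i < n) lebesgue_measure (A i))%E.
Proof.
elim: n A => [|n IH] A mA /=.
  rewrite big_ord0 diracE mem_set//; by case.
rewrite big_ord_recl -IH// -product_measure1E//.
  congr (product_measure1 _ _ _).
  apply/seteqP; split => -[x v] /=.
    move=> H; split; first by have := H ord0; rewrite rV_cons0.
    by move=> i; have := H (lift ord0 i); rewrite rV_consS.
  move=> [Hx Hv] i; case: (unliftP ord0 i) => [j|] ->; rewrite ?rV_consS ?rV_cons0//.
  exact: mA.
rewrite (_ : [set v | _] = \bigcap_(i in setT) (fun v : 'rV[R]_n => v ord0 i) @^-1` A (lift ord0 i)).
  apply: fin_bigcap_measurable => // i _.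
  by rewrite -[X in measurable X]setTI; exact: measurable_rV_coord.
by apply/seteqP; split => v /= H i; [move=> _; exact: H|exact: H].
Qed.
End lebesgue_measure_rV.

Section green_kernel.
Context {R : realType} {n : nat}.
Implicit Types x y : 'rV[R]_n.

(* Not the norm of the library on 'rV[R]_n, which is the sup norm. *)
Definition enorm x : R := Num.sqrt (\sum_(i < n) x ord0 i ^+ 2).

Definition heat_kernel (s : R) x y : R :=
  (4 * pi * s) `^ (- (n%:R / 2)) * expR (- (enorm (x - y) ^+ 2 / (4 * s))).

Definition Gamma (a : R) : R :=
  \int[lebesgue_measure]_(t in `]0, +oo[) (t `^ (a - 1) * expR (- t)).

(* Extended-real valued, since it is +oo on the diagonal. *)
Definition green_kernel (alpha : R) x y : \bar R :=
  (((Gamma alpha)^-1)%:E * \int[lebesgue_measure]_(s in `]0%R, +oo[)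
    (s `^ (alpha - 1) * heat_kernel s x y)%:E)%E.

(* When gamma < 0 the library sets 0 `^ gamma = 0; this only affects the
   integrand at the single point y = 0. *)
Definition supersolution (alpha gamma q : R) (u : 'rV[R]_n -> R) : Prop :=
  forall x, (\int[@lebesgue_rV R n]_y
    (green_kernel alpha x y * (u y `^ q)%:E * (enorm y `^ gamma)%:E) <=
    (u x)%:E)%E.

End green_kernel.

(* Main.v *)
Require Import Defs.
From mathcomp Require Import all_boot all_order all_algebra.
From mathcomp Require Import all_classical all_reals all_analysis.
From mathcomp Require Import measurable_realfun ring lra.
Import Order.TTheory GRing.Theory Num.Theory.
Import numFieldNormedType.Exports.
Local Open Scope classical_set_scope.
Local Open Scope ring_scope.

(** Write a = alpha, g = gamma, w = u^q |y|^g. The Green kernel is comparable to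
|x - y|^(2a - n), so the inequality says that u dominates, up to a constant, the
Riesz potential of order 2a of w. Everything rests on two explicit bounds of the
kernel, green_kernel_ge and green_kernel_le, read off the integral over s.

If a super-solution exists, let F(d) be the mass of w on the cube [-d, d]^n. The
points of the cube [-2d, 2d]^n are at distance O(d) from each other, so on it u
is at least c d^(2a - n) F(2d); in particular F is finite. Inserting this bound
in w on the corner box ]d, 2d]^n, which is disjoint from the cube [-d, d]^n and
where |y| is of order d, gives
  F(2d) >= F(d) + c d^(n + g - q (n - 2a)) F(2d)^q.
When q <= (n + g) / (n - 2a) the exponent of d is nonnegative, and along d = 2^k
the sequence F(2^k) both grows at least linearly in k and satisfies
c F(2^k)^q <= F(2^k), which bounds it as q > 1: this is impossible
(no_superlinear_growth). The critical exponent is covered by the same argument.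
This is supersolution_exponent_gt.

If q > (n + g) / (n - 2a), set b = (2a + g) / (q - 1). The power |x|^(-b) is the
profile for which both sides of the equation scale in the same way, and the
hypothesis on q is exactly b + 2a < n, that is, local integrability of
|y|^(-b q + g) = |y|^(-b - 2a). Its truncation max(1, |x|)^(-b), multiplied by a
small constant, is a continuous super-solution: with m the minimum of
|y|^(-b - 2a) and of some |y|^(-a2), 0 < a2 < 2a, which dominates the source, the
potential of m is bounded (riesz_potential_min_powers_bounded) and is
O(|x|^(-b)) (riesz_potential_power_le). Since q > 1 the source is superlinear in
the small factor, which absorbs the constants. This is supersolution_exists.

The potentials are estimated without polar coordinates: writing
  |x - y|^(-k) = k * (integral over t > |x - y| of t^(-k-1))
and exchanging the integrals turns the potential of f into an integral in one
variable of the f-masses of the balls of centre x (layer_cake_potential). The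
mass of a ball is bounded by a power of its radius t for small t and by another
one for large t, and integral_two_powers_le concludes. *)

(** * Comparison of integrals *)

Section integral_comparison.
Context d (T : measurableType d) {R : realType} (m : {measure set T -> \bar R}).
Local Open Scope ereal_scope.
Import HBNNSimple.

(** The integral of a nonnegative function is the supremum of the integrals of
the simple functions below it, hence monotone over all functions; the Green
kernel, itself an integral depending on y, is compared with powers this way. *)
Lemma ge0_integral_mono (D : set T) (f g : T -> \bar R) :
  (forall x, D x -> 0 <= f x) -> (forall x, D x -> f x <= g x) ->
  \int[m]_(x in D) f x <= \int[m]_(x in D) g x.
Proof.
move=> f0 fg; rewrite (integral_mkcond D f) (integral_mkcond D g).
have h0 x : 0 <= (f \_ D) x by exact: erestrict_ge0.
have hg x : (f \_ D) x <= (g \_ D) x by exact: lee_restrict.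
rewrite !ge0_integralTE//; last by move=> x; exact: le_trans (hg x).
apply: le_ereal_sup => _ [h hf <-]; exists h => // x.
exact: le_trans (hf x) (hg x).
Qed.

Lemma ge0_integral_mono_subset (D E : set T) (f g : T -> \bar R) :
  D `<=` E -> (forall x, D x -> 0 <= f x) -> (forall x, E x -> 0 <= g x) ->
  (forall x, D x -> f x <= g x) ->
  \int[m]_(x in D) f x <= \int[m]_(x in E) g x.
Proof.
move=> DE f0 g0 fg; rewrite integral_mkcond [leRHS]integral_mkcond.
apply: ge0_integral_mono => x _; first exact: erestrict_ge0.
rewrite !patchE; case: ifPn => xD; last by case: ifPn => // /set_mem/g0.
by rewrite (mem_set (DE _ (set_mem xD))); apply/fg/set_mem.
Qed.

Lemma integral_ge_cst (D E : set T) (f : T -> \bar R) (c : R) :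
  D `<=` E -> measurable D -> (0 <= c)%R ->
  (forall x, E x -> 0 <= f x) -> (forall x, D x -> c%:E <= f x) ->
  c%:E * m D <= \int[m]_(x in E) f x.
Proof.
move=> DE mD c0 f0 cf; rewrite -integral_cst//.
exact: ge0_integral_mono_subset.
Qed.

Lemma integral_le_cst (D : set T) (f : T -> \bar R) (c : R) :
  measurable D -> (forall x, D x -> 0 <= f x) -> (forall x, D x -> f x <= c%:E) ->
  \int[m]_(x in D) f x <= c%:E * m D.
Proof.
by move=> mD f0 fc; rewrite -integral_cst//; exact: ge0_integral_mono.
Qed.

(** A simple function below f loses nothing when it is restricted to the
complement of N, where it is below g. This discards the diagonal, where the
Green kernel is infinite, and the origin. *)
Lemma ge0_integral_mono_negligible (N : set T) (f g : T -> \bar R) :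
  measurable N -> m N = 0 -> (forall x, 0 <= f x) -> (forall x, 0 <= g x) ->
  (forall x, ~ N x -> f x <= g x) -> \int[m]_x f x <= \int[m]_x g x.
Proof.
move=> mN N0 f0 g0 fg; rewrite ge0_integralTE//.
apply: ge_ereal_sup => _ [h hf <-].
rewrite -integralT_nnsfun (ge0_negligible_integral _ _ _ _ N0)//; last 2 first.
- by apply/measurable_EFinP; exact: (@measurable_funPT _ _ _ _ h).
- by move=> x _; rewrite lee_fin.
apply: ge0_integral_mono_subset => // x [_ Nx]; first by rewrite lee_fin.
exact: le_trans (hf x) (fg _ Nx).
Qed.

End integral_comparison.

(** * Powers and their integrals over the half-line *)

Section power_integrals.
Context {R : realType}.
Notation mu := (@lebesgue_measure R).

Lemma gt0_powRD (t a b : R) : 0 < t -> t `^ a * t `^ b = t `^ (a + b).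
Proof. by move=> t0; rewrite powRD// (gt_eqF t0) implybT. Qed.

Lemma powRN_le (c s t : R) : 0 <= c -> 0 < s -> s <= t -> t `^ (- c) <= s `^ (- c).
Proof.
move=> c0 s0 st; have t0 := lt_le_trans s0 st.
rewrite !powRN lef_pV2 ?posrE ?powR_gt0//.
by apply: ge0_ler_powR => //; rewrite nnegrE ltW.
Qed.

(** From w / N <= exp (w / N), raised to the power N. With N = n / 2 it makes
the Gaussian factor cancel the singularity s^(-n/2) of the heat kernel. *)
Lemma expRN_le_powR (N w : R) : 0 < N -> 0 < w -> expR (- w) <= N `^ N * w `^ (- N).
Proof.
move=> N0 w0; rewrite expRN powRN.
have wN : w / N <= expR (w / N) by apply: le_trans (expR_ge1Dx _); rewrite lerDr.
have : (w / N) `^ N <= expR w.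
  apply: (@le_trans _ _ (expR (w / N) `^ N)).
    by apply: ge0_ler_powR; rewrite ?nnegrE ?expR_ge0 ?divr_ge0 ?(ltW N0) ?(ltW w0).
  by rewrite -expRM mulfVK ?gt_eqF.
rewrite powRM ?invr_ge0 ?(ltW N0) ?(ltW w0)// => h.
have Ni : (N^-1) `^ N = (N `^ N)^-1 by rewrite -(powR_inv1 (ltW N0)) -powRrM mulN1r powRN.
rewrite -[leRHS]invrK lef_pV2 ?posrE ?expR_gt0 ?invr_gt0 ?mulr_gt0 ?invr_gt0 ?powR_gt0//.
by rewrite invfM invrK mulrC -Ni.
Qed.

Lemma lebesgue_measure_itvcc (a b : R) : a <= b ->
  mu `[a, b]%classic = (b - a)%:E.
Proof.
rewrite le_eqVlt => /predU1P[->|ab].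
  by rewrite set_itv1 lebesgue_measure_set1 subrr.
by rewrite lebesgue_measure_itv/= lte_fin ab EFinB.
Qed.

Lemma within_itvcc_continuous_powR (c a b : R) : 0 < a ->
  {within `[a, b], continuous (@powR R ^~ c)}.
Proof.
move=> a0; apply: derivable_within_continuous => x.
rewrite in_itv/= => /andP[ax _]; apply: derivable_powR.
by rewrite in_itv/= andbT (lt_le_trans a0).
Qed.

Lemma gt0_continuous_powR (c x : R) : 0 < x -> {for x, continuous (@powR R ^~ c)}.
Proof.
move=> x0; apply: differentiable_continuous; apply/derivable1_diffP.
by apply: derivable_powR; rewrite in_itv/= andbT.
Qed.

Lemma powR_primitive (c x : R) : c != 0 -> 0 < x ->
  derivable (fun t : R => c^-1 * t `^ c) x 1 /\
  (fun t : R => c^-1 * t `^ c)^`()%classic x = x `^ (c - 1).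
Proof.
move=> c0 x0.
have dx : derivable (@powR R ^~ c) x 1.
  by apply: derivable_powR; rewrite in_itv/= andbT.
split; first exact: derivableM.
rewrite derive1E deriveM// -derive1E powR_derive1 ?in_itv/= ?andbT//.
rewrite -derive1E derive1_cst scaler0 addr0 /GRing.scale/= mulrA mulVf//.
by rewrite mul1r.
Qed.

Lemma powR_cvgy (c : R) : 0 < c -> x `^ (- c) @[x --> +oo] --> (0 : R).
Proof.
move=> c0; apply/cvgrPdist_lt => e e0; near=> x.
have x0 : 0 < x by near: x; exact: nbhs_pinfty_gt.
rewrite sub0r normrN ger0_norm ?powR_ge0//.
have ex : e `^ (- c^-1) < x by near: x; exact: nbhs_pinfty_gt.
have : (e `^ (- c^-1)) `^ c < x `^ c.
  by apply: gt0_ltr_powR => //; rewrite nnegrE ?powR_ge0// ltW.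
rewrite -powRrM mulNr mulVf ?gt_eqF// powR_inv1 ?ltW// => h.
by rewrite powRN -[ltRHS]invrK ltf_pV2// posrE ?invr_gt0// powR_gt0.
Unshelve. all: by end_near. Qed.

Lemma integral_powR_itvcc (c a b : R) : c != 0 -> 0 < a -> a < b ->
  (\int[mu]_(t in `[a, b]) (t `^ (c - 1))%:E =
   (c^-1 * b `^ c - c^-1 * a `^ c)%:E)%E.
Proof.
move=> c0 a0 ab; rewrite EFinB.
apply: (@continuous_FTC2 _ _ (fun t : R => c^-1 * t `^ c)) => //.
- exact: within_itvcc_continuous_powR.
- have cF x : 0 < x -> {for x, continuous (fun t : R => c^-1 * t `^ c)}.
    move=> x0; apply: differentiable_continuous; apply/derivable1_diffP.
    by have [] := powR_primitive c x c0 x0.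
  split.
  + move=> x; rewrite in_itv/= => /andP[ax _].
    by have [] := powR_primitive c x c0 (lt_trans a0 ax).
  + exact/cvg_at_right_filter/cF.
  + exact/cvg_at_left_filter/cF/(lt_trans a0).
- move=> x; rewrite in_itv/= => /andP[ax _].
  by have [] := powR_primitive c x c0 (lt_trans a0 ax).
Qed.

Lemma integral_powR_itvcy (c a : R) : 0 < c -> 0 < a ->
  (\int[mu]_(t in `[a, +oo[) (t `^ (- c - 1))%:E = (c^-1 * a `^ (- c))%:E)%E.
Proof.
move=> c0 a0.
have c'0 : - c != 0 by rewrite oppr_eq0 gt_eqF.
have pos x : a <= x -> 0 < x by exact: lt_le_trans.
have cF x : 0 < x -> {for x, continuous (fun t : R => (- c)^-1 * t `^ (- c))}.
  move=> x0; apply: differentiable_continuous; apply/derivable1_diffP.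
  by have [] := powR_primitive _ x c'0 x0.
rewrite (@ge0_continuous_FTC2y _ _ (fun t : R => (- c)^-1 * t `^ (- c)) a 0).
- by rewrite -EFinB sub0r invrN mulNr opprK.
- by move=> x _; exact: powR_ge0.
- apply/continuous_within_itvcyP; split.
    move=> x; rewrite in_itv/= andbT => ax.
    exact/gt0_continuous_powR/pos/ltW.
  exact/cvg_at_right_filter/gt0_continuous_powR.
- rewrite -[0 in X in _ --> X](mulr0 (- c)^-1).
  by apply: cvgM; [exact: cvg_cst|exact: powR_cvgy].
- by move=> x ax; have [] := powR_primitive _ x c'0 (pos _ (ltW ax)).
- exact/cvg_at_right_filter/cF.
- move=> x; rewrite in_itv/= andbT => ax.
  by have [] := powR_primitive _ x c'0 (pos _ (ltW ax)).
Qed.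

Lemma measurable_EFin_powR (D : set R) (c : R) :
  measurable_fun D (fun t : R => (t `^ c)%:E).
Proof.
by apply/measurable_EFinP; apply: measurable_funTS; exact: measurable_powR.
Qed.

(** For c < 1 the integrand is unbounded at 0: the bound comes from the
intervals [1/(k+1), b] by monotone convergence. *)
Lemma integral_powR_itvoc_le (c b : R) : 0 < c -> 0 < b ->
  (\int[mu]_(t in `]0%R, b[) (t `^ (c - 1))%:E <= (c^-1 * b `^ c)%:E)%E.
Proof.
move=> c0 b0.
pose F k : set R := `[k.+1%:R^-1, b]%classic.
have ndF : {homo F : k l / (k <= l)%N >-> (k <= l)%O}.
  move=> k l kl; rewrite subsetEset => x; rewrite /F/= !in_itv/= => /andP[+ ->].
  rewrite andbT; apply: le_trans.
  by rewrite lef_pV2 ?posrE// ler_nat.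
have cvF : (\int[mu]_(t in F k) (t `^ (c - 1))%:E)%E @[k --> \oo] -->
    (\int[mu]_(t in \bigcup_k F k) (t `^ (c - 1))%:E)%E.
  apply: ge0_nondecreasing_set_cvg_integral => //.
  - by move=> k; exact: measurable_itv.
  - by move=> k; exact: measurable_EFin_powR.
  - by move=> k x _; rewrite lee_fin powR_ge0.
apply: (@le_trans _ _ (\int[mu]_(t in \bigcup_i F i) (t `^ (c - 1))%:E)%E).
  apply: ge0_subset_integral => //.
  - by apply: bigcupT_measurable => k; exact: measurable_itv.
  - exact: measurable_EFin_powR.
  - by move=> x _; rewrite lee_fin powR_ge0.
  move=> x /=; rewrite in_itv/= => /andP[x0 xb].
  have [k kx] : exists k, k.+1%:R^-1 < x.
    have /= := @near_infty_natSinv_lt R (PosNum x0).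
    by case=> k _ /(_ k (leqnn _)) /= h; exists k.
  by exists k => //; rewrite /F/= in_itv/= !ltW.
rewrite -(cvg_lim _ cvF)//; apply: lime_le; first by apply/cvg_ex; eexists; exact: cvF.
near=> k; have [kb|bk] := ltP k.+1%:R^-1 b.
  rewrite integral_powR_itvcc ?invr_gt0// ?gt_eqF// lee_fin gerBl.
  by rewrite mulr_ge0 ?invr_ge0 ?ltW// powR_gt0// invr_gt0.
rewrite (@integral_Sset1 _ _ _ b).
  by rewrite lee_fin mulr_ge0 ?invr_ge0 ?powR_ge0// ltW.
move=> x; rewrite /F/= in_itv/= => /andP[kx xb].
by apply/eqP; rewrite eq_le xb (le_trans bk kx).
Unshelve. all: by end_near. Qed.

(** The one-variable estimate to which all the others reduce. The kernels met
below behave like one power of t below a scale T, integrable at 0, and like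
another one above T, integrable at infinity; T is then chosen to be the natural
length scale of the problem, 1 or |x|. *)
Lemma integral_two_powers_le (h : R -> \bar R) (A B p r T : R) :
  0 <= A -> 0 <= B -> 0 < p -> 0 < r -> 0 < T ->
  (forall t, 0 < t -> (0 <= h t)%E) ->
  (forall t, 0 < t -> t < T -> (h t <= (A * t `^ (p - 1))%:E)%E) ->
  (forall t, T <= t -> (h t <= (B * t `^ (- r - 1))%:E)%E) ->
  (\int[mu]_(t in `]0%R, +oo[) h t <=
   (A * (p^-1 * T `^ p) + B * (r^-1 * T `^ (- r)))%:E)%E.
Proof.
move=> A0 B0 p0 r0 T0 h0 hA hB.
pose g t : \bar R :=
  (if t < T then A * t `^ (p - 1) else B * t `^ (- r - 1))%:E.
have g0 t : (0 <= g t)%E.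
  by rewrite /g lee_fin; case: ifP => _; rewrite mulr_ge0// powR_ge0.
apply: (@le_trans _ _ (\int[mu]_(t in `]0%R, +oo[) g t)%E).
  apply: ge0_integral_mono => t /=; rewrite in_itv/= andbT => t0.
    exact: h0.
  by rewrite /g; case: ltP => tT; [exact: hA|exact: hB].
have mg : measurable_fun setT g.
  apply/measurable_EFinP; apply: measurable_fun_ifT.
  - exact: measurable_fun_ltr.
  - by apply: measurable_funM => //; exact: measurable_powR.
  - by apply: measurable_funM => //; exact: measurable_powR.
have -> : `]0%R, +oo[%classic = `]0%R, T[%classic `|` `[T, +oo[%classic :> set R.
  apply/seteqP; split=> t /=; rewrite !in_itv/= !andbT.
    by move=> ->/=; case: ltP => tT; [left|right].
  by move=> [/andP[]//|]; exact: lt_le_trans.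
rewrite ge0_integral_setU//=; last 2 first.
- exact: measurable_funTS.
- apply/disj_setPS => t [] /=; rewrite !in_itv/= andbT => /andP[_].
  by move=> /lt_le_trans/[apply]; rewrite ltxx.
rewrite EFinD; apply: leeD.
  rewrite (eq_integral (fun t : measurableTypeR R => A%:E * (t `^ (p - 1))%:E)%E); last first.
    move=> t; rewrite inE/= in_itv/= /g => /andP[_ ->]; by rewrite EFinM.
  rewrite ge0_integralZl_EFin//; last 2 first.
  - by move=> t _; rewrite lee_fin powR_ge0.
  - exact: measurable_EFin_powR.
  by rewrite EFinM lee_wpmul2l// integral_powR_itvoc_le.
rewrite (eq_integral (fun t : measurableTypeR R => B%:E * (t `^ (- r - 1))%:E)%E); last first.
  by move=> t; rewrite inE/= in_itv/= /g andbT => /le_gtF ->; rewrite EFinM.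
rewrite ge0_integralZl_EFin//; last 2 first.
- by move=> t _; rewrite lee_fin powR_ge0.
- exact: measurable_EFin_powR.
by rewrite integral_powR_itvcy// -EFinM.
Qed.

End power_integrals.

(** * Euclidean norm and Lebesgue measure on R^n *)

Section euclidean_norm.
Context {R : realType} {n : nat}.
Implicit Types x y : 'rV[R]_n.

Lemma enorm_ge0 x : 0 <= enorm x.
Proof. exact: sqrtr_ge0. Qed.

Lemma enorm_sq x : enorm x ^+ 2 = \sum_(i < n) x ord0 i ^+ 2.
Proof. by rewrite sqr_sqrtr// sumr_ge0// => i _; rewrite sqr_ge0. Qed.

Lemma coord_le_enorm x i : `|x ord0 i| <= enorm x.
Proof.
rewrite -ler_sqr ?nnegrE ?enorm_ge0// enorm_sq real_normK ?num_real//.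
rewrite (bigD1 i)//= lerDl sumr_ge0// => j _; exact: sqr_ge0.
Qed.

Lemma enorm_le x r : 0 <= r -> (forall i, `|x ord0 i| <= r) ->
  enorm x <= Num.sqrt n%:R * r.
Proof.
move=> r0 xr; rewrite -ler_sqr ?nnegrE ?enorm_ge0 ?mulr_ge0 ?sqrtr_ge0//.
rewrite enorm_sq exprMn sqr_sqrtr ?ler0n//.
rewrite [leRHS](_ : _ = \sum_(i < n) r ^+ 2); last first.
  by rewrite sumr_const card_ord mulr_natl.
apply: ler_sum => i _; rewrite -real_normK ?num_real//.
by rewrite ler_sqr ?nnegrE.
Qed.

Lemma enormN x : enorm (- x) = enorm x.
Proof. by congr Num.sqrt; apply: eq_bigr => i _; rewrite mxE sqrrN. Qed.

Lemma enorm_eq0 x : enorm x = 0 -> x = 0.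
Proof.
move=> x0; apply/rowP => i; rewrite mxE; apply/eqP.
by rewrite -normr_le0 (le_trans (coord_le_enorm x i))// x0.
Qed.

Lemma enorm_subr_gt0 x y : x != y -> 0 < enorm (x - y).
Proof.
move=> xy; rewrite lt_neqAle enorm_ge0 andbT eq_sym; apply: contra_neq xy.
by move=> /enorm_eq0/eqP; rewrite subr_eq0 => /eqP.
Qed.

(** Coordinatewise, x^2 <= 2 (x - y)^2 + 2 y^2, the difference being
(x - 2 y)^2. *)
Lemma enorm_half_le x y : enorm (x - y) <= enorm x / 2 -> enorm x / 2 <= enorm y.
Proof.
move=> xy; have hx := enorm_ge0 x; have hy := enorm_ge0 y.
have sq : enorm x ^+ 2 <= 2 * enorm (x - y) ^+ 2 + 2 * enorm y ^+ 2.
  rewrite !enorm_sq !mulr_sumr -big_split/=; apply: ler_sum => i _.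
  rewrite !mxE -subr_ge0.
  have -> : 2 * (x ord0 i - y ord0 i) ^+ 2 + 2 * y ord0 i ^+ 2 - x ord0 i ^+ 2 =
    (x ord0 i - 2 * y ord0 i) ^+ 2 by ring.
  exact: sqr_ge0.
have xy2 : enorm (x - y) ^+ 2 <= (enorm x / 2) ^+ 2.
  by rewrite ler_sqr ?nnegrE ?enorm_ge0 ?divr_ge0.
rewrite -ler_sqr ?nnegrE ?divr_ge0//; nra.
Qed.

Lemma measurable_enorm d (T : measurableType d) (f : T -> 'rV[R]_n) :
  measurable_fun setT f -> measurable_fun setT (fun t => enorm (f t)).
Proof.
move=> mf; apply: (@measurableT_comp _ _ _ _ _ _ (@Num.sqrt R)).
  by apply: continuous_measurable_fun; exact: sqrt_continuous.
apply: measurable_sum => i; apply: measurable_funX.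
exact: (measurableT_comp (measurable_rV_coord i) mf).
Qed.

Lemma measurable_subr_rV x d (T : measurableType d) (f : T -> 'rV[R]_n) :
  measurable_fun setT f -> measurable_fun setT (fun t => x - f t).
Proof.
move=> mf; apply/measurable_fun_rVP => i.
under eq_fun do rewrite !mxE.
apply: measurable_funB => //.
exact: (measurableT_comp (measurable_rV_coord i) mf).
Qed.

Lemma measurable_enorm_powR (c : R) :
  measurable_fun setT (fun y : 'rV[R]_n => enorm y `^ c).
Proof.
apply: (measurableT_comp (measurable_powR _)).
by apply: measurable_enorm; exact: measurable_id.
Qed.

Lemma continuous_enorm : continuous (@enorm R n).
Proof.
have cs : continuous (fun x : 'rV[R]_n => \sum_(i < n) x ord0 i ^+ 2).
  apply: continuous_big => [|i _ x]; first exact: add_continuous.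
  apply: (@continuous_comp _ _ _ (fun v : 'rV[R]_n => v ord0 i) (fun t => t ^+ 2)).
    exact: coord_continuous.
  exact: exprn_continuous.
move=> x; apply: (@continuous_comp _ _ _ _ (@Num.sqrt R)); first exact: cs.
exact: sqrt_continuous.
Qed.

End euclidean_norm.

Section lebesgue_measure_of_boxes.
Context {R : realType} {n : nat}.
Notation leb := (@lebesgue_rV R n).

Lemma measurable_rV_box (A : 'I_n -> set R) : (forall i, measurable (A i)) ->
  measurable [set v : 'rV[R]_n | forall i, A i (v ord0 i)].
Proof.
move=> mA; rewrite (_ : [set v | _] =
    \bigcap_(i in setT) (fun v : 'rV[R]_n => v ord0 i) @^-1` A i).
  apply: fin_bigcap_measurable => // i _.
  by rewrite -[X in measurable X]setTI; exact: measurable_rV_coord.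
by apply/seteqP; split => v /= H i; [move=> _; exact: H|exact: H].
Qed.

(** An open set is the union of the countably many boxes with rational centre
and side 2 / (k+1) that it contains. *)
Lemma open_measurable_rV (U : set 'rV[R]_n) : open U -> measurable U.
Proof.
move=> oU.
pose box (p : 'rV[rat]_n * nat) :=
  [set v : 'rV[R]_n | forall i,
    ball (ratr (p.1 ord0 i) : R) p.2.+1%:R^-1 (v ord0 i)].
have mbox p : measurable (box p).
  apply: (@measurable_rV_box
    (fun i => ball (ratr (p.1 ord0 i) : R) p.2.+1%:R^-1)) => i.
  exact: measurable_ball.
rewrite (_ : U = \bigcup_p if `[< box p `<=` U >] then box p else set0).
  apply: countable_bigcupT_measurable => [|p]; first exact: countableP.
  by case: ifP.
apply/seteqP; split => [x Ux|x [p _]]; last by case: asboolP => // pU /pU.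
have /nbhs_ballP[e /= e0 xeU] : nbhs x U by exact: open_nbhs_nbhs.
have [k ke] : exists k, k.+1%:R^-1 < e / 2.
  have /= := @near_infty_natSinv_lt R (PosNum (divr_gt0 e0 (ltr0n R 2))).
  by case=> k _ /(_ k (leqnn _)) /= h; exists k.
have k0 : (0 : R) < k.+1%:R^-1 by rewrite invr_gt0.
have /choice[q qx] : forall i, exists q : rat,
    ball (x ord0 i) k.+1%:R^-1 (ratr q : R).
  move=> i; have [||y [/= by' [q _ qy]]] :=
    @dense_rat R (ball (x ord0 i) k.+1%:R^-1).
  - by exists (x ord0 i); exact: ballxx.
  - exact: ball_open.
  - by exists q; rewrite qy.
have boxU : box (\row_i q i, k) `<=` U.
  move=> y ybox; apply: xeU; split=> // i j.
  rewrite (ord1 i); have := ybox j; rewrite /= mxE => yj.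
  apply: (@le_ball _ _ _ (k.+1%:R^-1 + k.+1%:R^-1)); last exact: ball_triangle yj.
  by rewrite [leRHS]splitr lerD// ltW.
exists (\row_i q i, k) => //; rewrite asboolT// => i.
by rewrite /= mxE; exact/ball_sym/qx.
Qed.

Lemma lower_semicontinuous_measurable_rV (f : 'rV[R]_n -> \bar R) :
  lower_semicontinuous f -> measurable_fun setT f.
Proof.
move=> /lower_semicontinuousP lscf.
apply: (measurability _ (ErealGenOInfty.measurableE R)).
move=> /= _ [_ [a ->]] <-; apply: measurableI => //.
by apply: open_measurable_rV; rewrite preimage_itvoy; exact: lscf.
Qed.

Lemma measurable_rV_set1 (x : 'rV[R]_n) : measurable [set x].
Proof.
rewrite (_ : [set x] = [set v | forall i, [set x ord0 i] (v ord0 i)]).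
  apply: (@measurable_rV_box (fun i => [set x ord0 i])) => i.
  exact: measurable_set1.
apply/seteqP; split => [v /= -> //|v /= h]; exact/rowP.
Qed.

Lemma lebesgue_rV_set1 (x : 'rV[R]_n) : (0 < n)%N -> leb [set x] = 0%E.
Proof.
move=> n0; rewrite (_ : [set x] = [set v | forall i, [set x ord0 i] (v ord0 i)]).
  rewrite (@lebesgue_rV_box _ _ (fun i => [set x ord0 i])); last first.
    by move=> i; exact: measurable_set1.
  rewrite (bigD1 (Ordinal n0))//= lebesgue_measure_set1 mul0e//.
apply/seteqP; split => [v /= -> //|v /= h]; exact/rowP.
Qed.

Definition eball (x : 'rV[R]_n) (t : R) : set 'rV[R]_n :=
  [set y | enorm (x - y) < t].

Lemma measurable_eball x t : measurable (eball x t).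
Proof.
rewrite -[X in measurable X]setTI.
have m : measurable_fun setT (fun y : 'rV[R]_n => enorm (x - y) < t).
  by apply: measurable_fun_ltr => //; exact/measurable_enorm/measurable_subr_rV.
exact: (m measurableT [set true]).
Qed.

(** The ball lies in the cube of side 2 t with the same centre. *)
Lemma lebesgue_rV_eball_le x t : 0 < t -> (leb (eball x t) <= ((2 * t) ^+ n)%:E)%E.
Proof.
move=> t0.
pose A i : set R := `](x ord0 i - t), (x ord0 i + t)[%classic.
have mA i : measurable (A i) by exact: measurable_itv.
apply: (@le_trans _ _ (leb [set v | forall i, A i (v ord0 i)])).
  apply: le_measure; rewrite ?inE.
  - exact: measurable_eball.
  - exact: measurable_rV_box.
  move=> y /= yx i; have := le_lt_trans (coord_le_enorm _ i) yx.
  by rewrite !mxE /A/= in_itv/= ltr_norml; lra.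
rewrite lebesgue_rV_box//.
under eq_bigr => i _.
  rewrite lebesgue_measure_itv/= lte_fin ifT; last by lra.
  rewrite -EFinB (_ : _ - _ = 2 * t); last by ring.
  over.
by rewrite prodEFin prodr_const card_ord.
Qed.

End lebesgue_measure_of_boxes.

(** * Layer cake formula for potentials *)

Section layer_cake.
Context {R : realType} {n : nat}.
Notation mu := (@lebesgue_measure R).
Notation leb := (@lebesgue_rV R n).

Lemma integral_eball_le_cst (f : 'rV[R]_n -> R) (x : 'rV[R]_n) (t c : R) :
  0 < t -> 0 <= c -> (forall y, 0 <= f y) -> (forall y, eball x t y -> f y <= c) ->
  (\int[leb]_(y in eball x t) (f y)%:E <= (c * (2 * t) ^+ n)%:E)%E.
Proof.
move=> t0 c0 f0 fc.
apply: (@le_trans _ _ (c%:E * leb (eball x t))%E).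
  apply: integral_le_cst; first exact: measurable_eball.
    by move=> y _; rewrite lee_fin.
  by move=> y yx; rewrite lee_fin fc.
by rewrite EFinM lee_wpmul2l// lebesgue_rV_eball_le.
Qed.

(** Integrate t^(- a - 1) over t > rho. At rho = 0 the left-hand side is 0,
by the convention 0 `^ (- a) = 0. *)
Lemma layer_cake_le (a rho : R) : 0 < a -> 0 <= rho ->
  ((rho `^ (- a))%:E <= a%:E * \int[mu]_(t in `]0%R, +oo[)
    (t `^ (- a - 1) * (if rho < t then 1 else 0))%:E)%E.
Proof.
move=> a0; rewrite le_eqVlt => /predU1P[<-|rho0].
  rewrite powR0 ?oppr_eq0 ?gt_eqF//; apply: mule_ge0; first by rewrite lee_fin ltW.
  apply: integral_ge0 => t _; rewrite lee_fin mulr_ge0 ?powR_ge0//.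
  by case: ifP.
rewrite -[X in (X%:E <= _)%E](mulVKf (lt0r_neq0 a0)) EFinM lee_pmul2l ?lte_fin//.
rewrite -integral_powR_itvcy// -integral_itv_obnd_cbnd; last exact: measurable_EFin_powR.
apply: ge0_integral_mono_subset => t /=; rewrite !in_itv/= !andbT.
- exact: lt_trans.
- by move=> _; rewrite lee_fin powR_ge0.
- by move=> _; rewrite lee_fin mulr_ge0 ?powR_ge0//; case: ifP.
- by move=> ->; rewrite mulr1.
Qed.

(** Insert the layer cake formula for |x - y|^(- a) and exchange the two
integrals by Tonelli's theorem. *)
Lemma layer_cake_potential (a : R) (f : 'rV[R]_n -> R) (x : 'rV[R]_n) :
  0 < a -> measurable_fun setT f -> (forall y, 0 <= f y) ->
  (\int[leb]_y (enorm (x - y) `^ (- a) * f y)%:E <=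
   a%:E * \int[mu]_(t in `]0%R, +oo[)
     ((t `^ (- a - 1))%:E * \int[leb]_(y in eball x t) (f y)%:E))%E.
Proof.
move=> a0 mf f0; have a0' := ltW a0.
pose g (z : 'rV[R]_n * measurableTypeR R) : \bar R :=
  (z.2 `^ (- a - 1) * (if enorm (x - z.1) < z.2 then 1 else 0) * f z.1)%:E.
have g0 z : (0 <= g z)%E.
  by rewrite lee_fin !mulr_ge0 ?powR_ge0//; case: ifP.
have mg : measurable_fun setT g.
  apply/measurable_EFinP; apply: measurable_funM; last first.
    exact: (measurableT_comp mf measurable_fst).
  apply: measurable_funM.
    exact: (measurableT_comp (measurable_powR _) measurable_snd).
  apply: measurable_fun_ifT => //; apply: measurable_fun_ltr => //.
  by apply: measurable_enorm; apply: measurable_subr_rV; exact: measurable_fst.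
have mgy y : measurable_fun setT (fun t => g (y, t)).
  exact: (measurableT_comp mg (measurable_pair1 y)).
have mF : measurable_fun setT (fun y => \int[mu]_t g (y, t))%E.
  exact: (@measurable_fun_fubini_tonelli_F _ _ _ _ _ (@lebesgue_measure R) g mg g0).
apply: (@le_trans _ _ (\int[leb]_y (a%:E * \int[mu]_t g (y, t)))%E).
  apply: ge0_integral_mono => y _.
    by rewrite lee_fin mulr_ge0 ?powR_ge0.
  rewrite EFinM muleC.
  apply: (@le_trans _ _ ((f y)%:E * (a%:E * \int[mu]_(t in `]0%R, +oo[)
      (t `^ (- a - 1) * (if enorm (x - y) < t then 1 else 0))%:E)))%E.
    by rewrite lee_wpmul2l ?lee_fin// layer_cake_le ?enorm_ge0.
  rewrite muleCA lee_wpmul2l ?lee_fin//.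
  have h0 t : (0 <= (t `^ (- a - 1) * (if (enorm (x - y) < t) then 1 else 0))%:E)%E.
    by rewrite lee_fin mulr_ge0 ?powR_ge0//; case: ifP.
  rewrite -ge0_integralZl_EFin//; last first.
    apply/measurable_EFinP; apply: measurable_funM.
      by apply: measurable_funTS; exact: measurable_powR.
    apply: measurable_funTS; apply: measurable_fun_ifT => //.
    exact: measurable_fun_ltr.
  apply: ge0_integral_mono_subset => // t _.
    by apply: mule_ge0 => //; rewrite lee_fin.
  by rewrite /g -EFinM lee_fin mulrC.
rewrite ge0_integralZl_EFin//; last first.
  by move=> y _; exact: integral_ge0.
rewrite lee_wpmul2l ?lee_fin//.
rewrite (fubini_tonelli g mg g0) [leRHS]integral_mkcond/=.
apply: ge0_integral_mono => t _; first exact: integral_ge0.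
rewrite patchE; case: ifPn => [|/negP t0]; last first.
  rewrite integral0_eq// => y _; rewrite /g /=; case: ifPn; rewrite ?mulr0 ?mul0r//.
  move=> /(le_lt_trans (enorm_ge0 _)) t1; exfalso; apply: t0.
  by rewrite inE/= in_itv/= t1.
rewrite inE/= in_itv/= andbT => t0; rewrite (integral_mkcond (eball x t)).
rewrite -ge0_integralZl_EFin ?powR_ge0//; last 2 first.
- by move=> y _; apply: erestrict_ge0 => z _; rewrite lee_fin.
- apply/(measurable_restrictT _ _).1; first exact: measurable_eball.
  by apply/measurable_EFinP; exact: measurable_funTS.
apply: ge0_integral_mono => y _ //.
rewrite /g/= patchE; case: ifPn => [yx|/negP].
  by rewrite (mem_set (yx : eball x t y)) mulr1 EFinM.
by move=> xy; rewrite memNset// mulr0 mul0r mule0.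
Qed.

End layer_cake.

(** * Riesz potentials of powers *)

Section riesz_potentials.
Context {R : realType} {n : nat}.
Notation leb := (@lebesgue_rV R n).

(** The mass of a ball is estimated by layer_cake_potential, centred at the
origin and applied to the indicator function f of the ball: the intersection of
the ball of radius r with a ball of radius t centred at the origin has volume at
most (2 min(t, r))^n, whatever its centre x is. *)
Lemma integral_eball_power_le (a : R) : 0 < a -> a < n%:R ->
  exists2 C : R, 0 <= C & forall (x : 'rV[R]_n) (r : R), 0 < r ->
  (\int[leb]_(y in eball x r) (enorm y `^ (- a))%:E <= (C * r `^ (n%:R - a))%:E)%E.
Proof.
move=> a0 an; have na0 : 0 < n%:R - a by lra.
exists (a * (2 ^+ n * (n%:R - a)^-1 + 2 ^+ n * a^-1)).
  rewrite mulr_ge0 ?ltW// addr_gt0// mulr_gt0 ?exprn_gt0 ?invr_gt0//.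
move=> x r r0.
pose f (y : 'rV[R]_n) : R := if enorm (x - y) < r then 1 else 0.
have f0 y : 0 <= f y by rewrite /f; case: ifP.
have f1 y : f y <= 1 by rewrite /f; case: ifP.
have mf : measurable_fun setT f.
  apply: measurable_fun_ifT => //; apply: measurable_fun_ltr => //.
  by apply: measurable_enorm; exact: measurable_subr_rV.
apply: (@le_trans _ _ (\int[leb]_y (enorm (0 - y) `^ (- a) * f y)%:E)%E).
  apply: ge0_integral_mono_subset => // y.
  - by rewrite lee_fin powR_ge0.
  - by rewrite lee_fin mulr_ge0 ?powR_ge0.
  - by rewrite /eball/= /f => ->; rewrite mulr1 sub0r enormN.
apply: (le_trans (layer_cake_potential _ f 0 a0 mf f0)).
apply: (@le_trans _ _ (a%:E * (2 ^+ n * ((n%:R - a)^-1 * r `^ (n%:R - a)) +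
   (2 * r) ^+ n * (a^-1 * r `^ (- a)))%:E)%E); last first.
  rewrite -EFinM lee_fin -mulrA ler_pM2l// exprMn -(powR_mulrn _ (ltW r0)).
  by rewrite -gt0_powRD//; lra.
rewrite lee_wpmul2l ?lee_fin ?(ltW a0) ?(ltW nb0)//.
apply: integral_two_powers_le => //.
- by rewrite exprn_ge0// mulr_ge0// ltW.
- move=> t t0; rewrite mule_ge0 ?lee_fin ?powR_ge0//.
  by apply: integral_ge0 => y _; rewrite lee_fin.
- move=> t t0 tr.
  apply: (@le_trans _ _ ((t `^ (- a - 1))%:E * (1 * (2 * t) ^+ n)%:E)%E).
    by rewrite lee_wpmul2l ?lee_fin ?powR_ge0// integral_eball_le_cst.
  rewrite -EFinM lee_fin mul1r exprMn -(powR_mulrn _ (ltW t0)) mulrCA gt0_powRD//.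
  by rewrite (_ : - a - 1 + _ = n%:R - a - 1)//; ring.
- move=> t rt; have t0 := lt_le_trans r0 rt.
  rewrite mulrC EFinM lee_wpmul2l ?lee_fin ?powR_ge0//.
  rewrite -[(2 * r) ^+ n]mul1r.
  apply: le_trans (integral_eball_le_cst (fun=> 1) x r 1 r0 _ _ _) => //.
  rewrite integral_mkcond [leRHS]integral_mkcond.
  apply: ge0_integral_mono => y _.
    by apply: erestrict_ge0 => z _; rewrite lee_fin.
  rewrite !patchE /f; case: ifPn => _; last by case: ifPn.
  case: ifPn => xy; last by case: ifPn.
  by rewrite (mem_set (xy : eball x r y)).
Qed.

(** On a ball of centre x which stays away from the origin, |y| is at least
|x| / 2. *)
Lemma integral_far_eball_power_le (a : R) (x : 'rV[R]_n) (t : R) : 0 <= a ->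
  0 < t -> t <= enorm x / 2 ->
  (\int[leb]_(y in eball x t) (enorm y `^ (- a))%:E <=
   ((enorm x / 2) `^ (- a) * (2 * t) ^+ n)%:E)%E.
Proof.
move=> a0 t0 tx; apply: integral_eball_le_cst => //.
- exact: powR_ge0.
- by move=> y; exact: powR_ge0.
- move=> y yx; apply: powRN_le => //; first exact: lt_le_trans tx.
  by apply: enorm_half_le; apply: le_trans tx; rewrite ltW.
Qed.

(** The mass of the ball of radius t and centre x is at most a multiple of
t^n |x|^(- a) for t < |x| / 2, and of t^(n - a) beyond. *)
Lemma riesz_potential_power_le (b a : R) : 0 < b -> b < a -> a < n%:R ->
  exists2 C : R, 0 <= C & forall x : 'rV[R]_n, 0 < enorm x ->
  (\int[leb]_y (enorm (x - y) `^ (- (n%:R - b)) * enorm y `^ (- a))%:E <=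
   (C * enorm x `^ (b - a))%:E)%E.
Proof.
move=> b0 ba an; have a0 : 0 < a by lra.
have nb0 : 0 < n%:R - b by lra.
have ab0 : 0 < a - b by lra.
have [C C0 HC] := integral_eball_power_le a a0 an.
pose K := (n%:R - b) * (2 ^+ n * b^-1 + C * (a - b)^-1).
exists (K * 2 `^ (a - b)).
  rewrite mulr_ge0 ?powR_ge0//.
  rewrite /K mulr_ge0 ?(ltW nb0)// addr_ge0 ?mulr_ge0//.
  - by rewrite invr_ge0 ltW.
  - by rewrite invr_ge0 ltW.
move=> x x0; set T := enorm x / 2; have T0 : 0 < T by rewrite divr_gt0.
have -> : K * 2 `^ (a - b) * enorm x `^ (b - a) = K * T `^ (b - a).
  rewrite /T powRM ?enorm_ge0 ?invr_ge0//.
  have -> : (2^-1 : R) `^ (b - a) = 2 `^ (a - b).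
    by rewrite -(powR_inv1 (ler0n R 2)) -powRrM mulN1r opprB.
  by ring.
apply: (le_trans (layer_cake_potential _ _ x nb0 (measurable_enorm_powR _) _)).
  by move=> y; exact: powR_ge0.
apply: (@le_trans _ _ ((n%:R - b)%:E *
   ((2 ^+ n * T `^ (- a)) * (b^-1 * T `^ b) + C * ((a - b)^-1 * T `^ (- (a - b))))%:E)%E).
  rewrite lee_wpmul2l ?lee_fin ?(ltW a0) ?(ltW nb0)//.
  apply: integral_two_powers_le => //.
  - by rewrite mulr_ge0 ?exprn_ge0 ?powR_ge0.
  - move=> t t0; rewrite mule_ge0 ?lee_fin ?powR_ge0//.
    by apply: integral_ge0 => y _; rewrite lee_fin powR_ge0.
  - move=> t t0 tT.
    apply: (@le_trans _ _ ((t `^ (- (n%:R - b) - 1))%:E * (T `^ (- a) * (2 * t) ^+ n)%:E)%E).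
      rewrite lee_wpmul2l ?lee_fin ?powR_ge0//.
      by apply: integral_far_eball_power_le => //; exact: ltW.
    rewrite -EFinM lee_fin exprMn -(powR_mulrn _ (ltW t0)).
    rewrite (_ : b - 1 = (- (n%:R - b) - 1) + n%:R); last by ring.
    by rewrite -(gt0_powRD t (- (n%:R - b) - 1))//; lra.
  - move=> t Tt; have t0 := lt_le_trans T0 Tt.
    apply: (@le_trans _ _ ((t `^ (- (n%:R - b) - 1))%:E * (C * t `^ (n%:R - a))%:E)%E).
      by rewrite lee_wpmul2l ?lee_fin ?powR_ge0// HC.
    rewrite -EFinM lee_fin.
    rewrite (_ : - (a - b) - 1 = (- (n%:R - b) - 1) + (n%:R - a)); last by ring.
    by rewrite -(gt0_powRD t (- (n%:R - b) - 1))//; lra.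
rewrite -EFinM lee_fin /K opprB.
have -> : T `^ (b - a) = T `^ (- a) * T `^ b by rewrite gt0_powRD// addrC.
lra.
Qed.

(** The power a1 > b ensures convergence at infinity and the power a2 < b
ensures that the bound persists at the origin; the scale is T = 1. *)
Lemma riesz_potential_min_powers_bounded (b a1 a2 : R) :
  0 < a2 -> a2 < b -> b < a1 -> a1 < n%:R ->
  exists2 C : R, 0 <= C & forall x : 'rV[R]_n,
  (\int[leb]_y (enorm (x - y) `^ (- (n%:R - b)) *
     Num.min (enorm y `^ (- a1)) (enorm y `^ (- a2)))%:E <= C%:E)%E.
Proof.
move=> a20 a2b ba1 a1n; have nb0 : 0 < n%:R - b by lra.
have a10 : 0 < a1 by lra.
have a2n : a2 < n%:R by lra.
have [C1 C10 HC1] := integral_eball_power_le a1 a10 a1n.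
have [C2 C20 HC2] := integral_eball_power_le a2 a20 a2n.
pose m (y : 'rV[R]_n) := Num.min (enorm y `^ (- a1)) (enorm y `^ (- a2)).
have m0 y : 0 <= m y by rewrite le_min !powR_ge0.
have mm : measurable_fun setT m.
  apply: (measurable_minr (measurable_enorm_powR _) (measurable_enorm_powR _)).
exists ((n%:R - b) * (C2 * ((b - a2)^-1 * 1 `^ (b - a2)) +
   C1 * ((a1 - b)^-1 * 1 `^ (- (a1 - b))))).
  rewrite !powR1 mulr_ge0 ?(ltW nb0)// addr_ge0 ?mulr_ge0// invr_ge0; lra.
move=> x.
apply: (le_trans (layer_cake_potential _ m x nb0 mm m0)).
rewrite EFinM lee_wpmul2l ?lee_fin ?(ltW nb0)//.
apply: integral_two_powers_le => //; [lra|lra| | |].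
- move=> t t0; rewrite mule_ge0 ?lee_fin ?powR_ge0//.
  by apply: integral_ge0 => y _; rewrite lee_fin.
- move=> t t0 _.
  apply: (@le_trans _ _ ((t `^ (- (n%:R - b) - 1))%:E * (C2 * t `^ (n%:R - a2))%:E)%E).
    rewrite lee_wpmul2l ?lee_fin ?powR_ge0//; apply: le_trans (HC2 x t t0).
    apply: ge0_integral_mono => y _; rewrite lee_fin//.
    by rewrite ge_min lexx orbT.
  rewrite -EFinM lee_fin.
  rewrite (_ : (b - a2) - 1 = (- (n%:R - b) - 1) + (n%:R - a2)); last by ring.
  by rewrite -(gt0_powRD t (- (n%:R - b) - 1))//; lra.
- move=> t t1; have t0 : 0 < t by exact: lt_le_trans t1.
  apply: (@le_trans _ _ ((t `^ (- (n%:R - b) - 1))%:E * (C1 * t `^ (n%:R - a1))%:E)%E).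
    rewrite lee_wpmul2l ?lee_fin ?powR_ge0//; apply: le_trans (HC1 x t t0).
    apply: ge0_integral_mono => y _; rewrite lee_fin//.
    by rewrite ge_min lexx.
  rewrite -EFinM lee_fin.
  rewrite (_ : - (a1 - b) - 1 = (- (n%:R - b) - 1) + (n%:R - a1)); last by ring.
  by rewrite -(gt0_powRD t (- (n%:R - b) - 1))//; lra.
Qed.

End riesz_potentials.

(** * Two-sided bounds of the Green kernel *)

Section green_kernel_bounds.
Context {R : realType}.
Notation mu := (@lebesgue_measure R).

(** The point is the finiteness of the integral: otherwise Gamma a would be 0
by convention, and so would be its inverse. *)
Lemma Gamma_gt0 (a : R) : 0 < a -> a < 1 -> 0 < Gamma a.
Proof.
move=> a0 a1; rewrite /Gamma /Rintegral.
set I := (\int[_]_(x in _) _)%E.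
have f0 t : (0 <= (t `^ (a - 1) * expR (- t))%:E)%E.
  by rewrite lee_fin mulr_ge0 ?powR_ge0 ?expR_ge0.
have Ioo : (I < +oo)%E.
  have r0 : 0 < 1 - a by lra.
  have le : (I <= (1 * (a^-1 * 1 `^ a) + 1 * ((1 - a)^-1 * 1 `^ (- (1 - a))))%:E)%E.
    apply: integral_two_powers_le => // t.
      move=> t0 _; rewrite lee_fin mul1r ler_piMr ?powR_ge0//.
      by rewrite -expR0 ler_expR oppr_le0 ltW.
    move=> t1; have t0 : 0 < t by exact: lt_le_trans t1.
    rewrite lee_fin mul1r (_ : - (1 - a) - 1 = (a - 1) + (- 1)); last by ring.
    rewrite -(gt0_powRD t (a - 1))// ler_wpM2l ?powR_ge0// powR_inv1 ?(ltW t0)//.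
    rewrite expRN lef_pV2 ?posrE ?expR_gt0//.
    by apply: le_trans (expR_ge1Dx t); rewrite lerDr.
  exact: le_lt_trans le (ltry _).
have I0 : (0 < I)%E.
  have ge : ((2 `^ (- (1 - a)) * expR (- 2))%:E * mu `[1%R, 2%R]%classic <= I)%E.
    apply: integral_ge_cst => // [t /=|t].
      by rewrite !in_itv/= andbT => /andP[t1 _]; exact: lt_le_trans t1.
    rewrite /= in_itv/= => /andP[t1 t2]; have t0 : 0 < t by exact: lt_le_trans t1.
    rewrite lee_fin ler_pM ?powR_ge0 ?expR_ge0// ?ler_expR ?lerN2//.
    have -> : a - 1 = - (1 - a) by rewrite opprB.
    apply: powRN_le => //.
    by rewrite subr_ge0 ltW.
  by apply: lt_le_trans ge; rewrite lebesgue_measure_itvcc ?ler1n.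
by apply: fine_gt0; rewrite I0 Ioo.
Qed.

Context (n : nat) (alpha : R).
Context (alpha_gt0 : 0 < alpha) (alpha_lt1 : alpha < 1).
Context (n_gt : 2 * alpha < n%:R).
Implicit Types x y : 'rV[R]_n.

Lemma green_integrand_ge0 x y (s : R) :
  (0 <= (s `^ (alpha - 1) * heat_kernel s x y)%:E)%E.
Proof. by rewrite lee_fin !mulr_ge0 ?powR_ge0 ?expR_ge0. Qed.

Lemma green_kernel_ge0 x y : (0 <= green_kernel alpha x y)%E.
Proof.
apply: mule_ge0; first by rewrite lee_fin invr_ge0 ltW// Gamma_gt0.
by apply: integral_ge0 => s _; exact: green_integrand_ge0.
Qed.

(** The times s in [r^2, 2 r^2] suffice: there s and r^2 are comparable and
the Gaussian factor is at least exp (- 1/4). *)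
Lemma green_kernel_ge : exists2 c : R, 0 < c & forall x y (r : R), 0 < r ->
  enorm (x - y) <= r ->
  ((c * r `^ (2 * alpha - n%:R))%:E <= green_kernel alpha x y)%E.
Proof.
have G0 := Gamma_gt0 alpha alpha_gt0 alpha_lt1.
have pi0 := @pi_gt0 R.
pose c := 2 `^ (alpha - 1) * (8 * pi) `^ (- (n%:R / 2)) * expR (- (1 / 4)) : R.
have c0 : 0 < c by rewrite /c !mulr_gt0 ?powR_gt0 ?expR_gt0 ?mulr_gt0.
exists ((Gamma alpha)^-1 * c); first by rewrite mulr_gt0 ?invr_gt0.
move=> x y r r0 xyr; rewrite /green_kernel -mulrA EFinM.
rewrite lee_wpmul2l ?lee_fin ?invr_ge0 ?(ltW G0)//.
have r20 : 0 < r ^+ 2 by rewrite exprn_gt0.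
have r2E (k : R) : (r ^+ 2) `^ k = r `^ (2 * k).
  by rewrite -(powR_mulrn _ (ltW r0)) -powRrM.
have -> : c * r `^ (2 * alpha - n%:R) =
  ((2 * r ^+ 2) `^ (- (1 - alpha)) * ((8 * pi * r ^+ 2) `^ (- (n%:R / 2)) *
    expR (- (1 / 4)))) * (2 * r ^+ 2 - r ^+ 2).
  rewrite /c opprB (@powRM _ 2 (r ^+ 2)) ?(@powRM _ (8 * pi) (r ^+ 2)) ?mulr_ge0 ?(ltW r0) ?(ltW pi0)// !r2E.
  rewrite (_ : 2 * r ^+ 2 - r ^+ 2 = r `^ 2); last by rewrite (powR_mulrn 2 (ltW r0)); ring.
  rewrite (_ : 2 * alpha - n%:R = 2 * (alpha - 1) + (2 * (- (n%:R / 2)) + 2)); last by field.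
  by rewrite -(gt0_powRD r (2 * (alpha - 1)))// -(gt0_powRD r _ 2)//; ring.
rewrite EFinM -lebesgue_measure_itvcc; last by lra.
apply: integral_ge_cst => // [s /=| | |s].
- by rewrite !in_itv/= andbT => /andP[rs _]; exact: lt_le_trans rs.
- by rewrite !mulr_ge0 ?powR_ge0 ?expR_ge0.
- by move=> s _; exact: green_integrand_ge0.
rewrite /= in_itv/= => /andP[rs s2]; have s0 : 0 < s by exact: lt_le_trans rs.
rewrite lee_fin -(opprB 1) !ler_pM ?mulr_ge0 ?powR_ge0 ?expR_ge0//.
- by apply: powRN_le => //; rewrite subr_ge0 ltW.
- apply: powRN_le; [by rewrite divr_ge0|by rewrite !mulr_gt0|].
  by rewrite (_ : 8 * pi * r ^+ 2 = 4 * pi * (2 * r ^+ 2)) ?ler_pM2l ?mulr_gt0//; ring.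
- rewrite ler_expR lerN2 ler_pdivrMr ?mulr_gt0//.
  have : enorm (x - y) ^+ 2 <= r ^+ 2 by rewrite ler_sqr ?nnegrE ?enorm_ge0// ltW.
  lra.
Qed.

(** Times s >= |x - y|^2 contribute through s^(alpha - 1 - n/2). For shorter
times the Gaussian factor bounds the heat kernel by a multiple of
|x - y|^(- n), leaving the integrable power s^(alpha - 1). *)
Lemma green_kernel_le : exists2 C : R, 0 <= C & forall x y, x != y ->
  (green_kernel alpha x y <= (C * enorm (x - y) `^ (- (n%:R - 2 * alpha)))%:E)%E.
Proof.
have G0 := Gamma_gt0 alpha alpha_gt0 alpha_lt1.
have pi0 := @pi_gt0 R.
pose N : R := n%:R / 2.
have n0 : 0 < n%:R :> R by apply: lt_trans n_gt; rewrite mulr_gt0.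
have N0 : 0 < N by rewrite divr_gt0.
have r0 : 0 < N - alpha by rewrite subr_gt0 ltr_pdivlMr// mulrC.
pose A := (4 * pi) `^ (- N) * (N `^ N * 4 `^ N) : R.
pose B := (4 * pi) `^ (- N) : R.
have A0 : 0 <= A by rewrite /A !mulr_ge0 ?powR_ge0.
have B0 : 0 <= B by exact: powR_ge0.
exists ((Gamma alpha)^-1 * (A * alpha^-1 + B * (N - alpha)^-1)).
  apply: mulr_ge0; first by rewrite invr_ge0 ltW.
  by apply: addr_ge0; apply: mulr_ge0; rewrite ?invr_ge0 ?(ltW r0) ?(ltW alpha_gt0).
move=> x y /enorm_subr_gt0; set z := enorm (x - y) => z0.
have z20 : 0 < z ^+ 2 by rewrite exprn_gt0.
have z2E (k : R) : (z ^+ 2) `^ k = z `^ (2 * k).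
  by rewrite -(powR_mulrn _ (ltW z0)) -powRrM.
rewrite /green_kernel -mulrA EFinM.
rewrite lee_wpmul2l ?lee_fin ?invr_ge0 ?(ltW G0)//.
have -> : (A / alpha + B / (N - alpha)) * z `^ (- (n%:R - 2 * alpha)) =
  (A * z `^ (2 * (- N))) * (alpha^-1 * (z ^+ 2) `^ alpha) +
  B * ((N - alpha)^-1 * (z ^+ 2) `^ (- (N - alpha))).
  rewrite !z2E.
  rewrite (_ : 2 * - (N - alpha) = - (n%:R - 2 * alpha)); last by rewrite /N; field.
  rewrite (_ : - (n%:R - 2 * alpha) = 2 * (- N) + 2 * alpha); last by rewrite /N; field.
  by rewrite -(gt0_powRD z (2 * (- N)))//; ring.
have heatE s : 0 < s -> heat_kernel s x y = B * s `^ (- N) * expR (- (z ^+ 2 / (4 * s))).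
  by move=> s0; rewrite /heat_kernel powRM ?mulr_ge0 ?(ltW pi0) ?(ltW s0).
apply: integral_two_powers_le => //.
- by rewrite mulr_ge0 ?powR_ge0.
- by move=> s _; exact: green_integrand_ge0.
- move=> s s0 _; rewrite lee_fin heatE//.
  have w0 : 0 < z ^+ 2 / (4 * s) by rewrite divr_gt0 ?mulr_gt0.
  apply: (@le_trans _ _ (s `^ (alpha - 1) * (B * s `^ (- N) *
      (N `^ N * (z ^+ 2 / (4 * s)) `^ (- N))))).
    rewrite ler_wpM2l ?powR_ge0// ler_wpM2l ?mulr_ge0 ?powR_ge0//.
    exact: expRN_le_powR.
  rewrite powRM ?(ltW z20) ?invr_ge0 ?mulr_ge0 ?(ltW s0)// z2E.
  have -> : (4 * s)^-1 `^ (- N) = 4 `^ N * s `^ N.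
    have s40 : 0 <= 4 * s by rewrite mulr_ge0 ?(ltW s0).
    by rewrite -(powR_inv1 s40) -powRrM mulN1r opprK powRM ?(ltW s0).
  rewrite le_eqVlt; apply/orP; left; apply/eqP; rewrite /A.
  have sN : s `^ (- N) * s `^ N = 1 by rewrite gt0_powRD// addrC subrr powRr0.
  transitivity ((s `^ (- N) * s `^ N) * (B * (N `^ N * 4 `^ N) * z `^ (2 * - N) * s `^ (alpha - 1))).
    by ring.
  by rewrite sN mul1r.
- move=> s zs; have s0 : 0 < s by exact: lt_le_trans zs.
  rewrite lee_fin heatE//.
  rewrite (_ : - (N - alpha) - 1 = - N + (alpha - 1)); last by ring.
  rewrite -(gt0_powRD s (- N))// [leLHS]mulrC mulrA ler_wpM2r ?powR_ge0//.
  rewrite ler_piMr ?mulr_ge0 ?powR_ge0//.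
  by rewrite -expR0 ler_expR oppr_le0 divr_ge0 ?sqr_ge0// mulr_ge0 ?(ltW s0).
Qed.

End green_kernel_bounds.

(** * Supercritical exponents: a super-solution *)

Section existence.
Context {R : realType} (n : nat).
Notation leb := (@lebesgue_rV R n).

(** Equal to min(1, |x|^(- b)) for x != 0, and to 1 at the origin, where
0 `^ (- b) would be 0. *)
Definition cutoff (b : R) (x : 'rV[R]_n) : R := Num.max 1 (enorm x) `^ (- b).

Lemma max1_gt0 (t : R) : 0 < Num.max 1 t.
Proof. by rewrite lt_max ltr01. Qed.

(** The weight rho^g may be singular at 0 (g < 0), which is why the bound near
the origin is a power rather than a constant. *)
Lemma cutoff_power_le (a1 a2 s g rho : R) : 0 < rho -> 0 <= s ->
  a1 = s - g -> a2 <= a1 -> - a2 <= g ->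
  Num.max 1 rho `^ (- s) * rho `^ g <= Num.min (rho `^ (- a1)) (rho `^ (- a2)).
Proof.
move=> r0 s0 a1E a21 a2g.
have le1 : Num.max 1 rho `^ (- s) * rho `^ g <= rho `^ (- a1).
  rewrite a1E opprB addrC -gt0_powRD// ler_wpM2r ?powR_ge0//.
  by apply: powRN_le => //; rewrite le_max lexx orbT.
rewrite le_min le1/=; have /orP[r1|r1] := le_total rho 1; last first.
  by apply: (le_trans le1); apply: ler_powR => //; rewrite lerN2.
apply: (@le_trans _ _ (rho `^ g)).
  rewrite ler_piMl ?powR_ge0//.
  have /(powRN_le s) : 1 <= Num.max 1 rho by rewrite le_max lexx.
  by rewrite powR1; exact.
by apply: ger_powR => //; rewrite r0.
Qed.

Lemma continuous_cutoff (b : R) : continuous (cutoff b).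
Proof.
move=> x; apply: (@continuous_comp _ _ _ (fun x : 'rV[R]_n => Num.max 1 (enorm x)) (@powR R ^~ (- b))); last first.
  by apply: gt0_continuous_powR; exact: max1_gt0.
apply: (@continuous_max _ _ (fun=> 1) (@enorm R n)); first exact: cst_continuous.
exact: continuous_enorm.
Qed.

Lemma continuous_lower_semicontinuous {X : topologicalType} (u : X -> R) : continuous u ->
  lower_semicontinuous (EFin \o u).
Proof.
move=> cu; apply/lower_semicontinuousP => a.
rewrite (_ : [set x | _] = u @^-1` [set t | a < t]).
  by move/continuousP : cu; apply; exact: open_gt.
by apply/seteqP; split => x /=; rewrite lte_fin.
Qed.

Lemma supersolution_exists (alpha gamma q : R) : 0 < alpha -> alpha < 1 ->
  2 * alpha < n%:R -> - (2 * alpha) < gamma -> 1 < q ->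
  (n%:R + gamma) / (n%:R - 2 * alpha) < q ->
  exists u : 'rV[R]_n -> R,
   [/\ forall x, 0 < u x,
       lower_semicontinuous (EFin \o u) &
       supersolution alpha gamma q u].
Proof.
move=> alpha_gt0 alpha_lt1 n_gt gamma_gt q1 hq.
have n_gt0 : (0 < n)%N.
  by rewrite -(ltr0n R); apply: lt_trans n_gt; rewrite mulr_gt0.
have n2 : 0 < n%:R - 2 * alpha by lra.
have q10 : 0 < q - 1 by lra.
pose b := (2 * alpha + gamma) / (q - 1).
have ag0 : 0 < 2 * alpha + gamma by lra.
have b0 : 0 < b by rewrite divr_gt0.
have bq : b * q - gamma = b + 2 * alpha.
  have : b * (q - 1) = 2 * alpha + gamma by rewrite mulfVK ?gt_eqF.
  lra.
have bn : b < n%:R - 2 * alpha.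
  move: hq; rewrite !ltr_pdivrMr// => hq.
  have : q * (n%:R - 2 * alpha) = (n%:R - 2 * alpha) * (q - 1) + (n%:R - 2 * alpha) by ring.
  lra.
pose a1 := b + 2 * alpha.
(* Any exponent in ]0, 2 alpha[ with - a2 <= gamma will do; the condition
   gamma > - 2 alpha leaves room for one. *)
pose a2 := Num.max (- gamma) alpha.
have a20 : 0 < a2 by rewrite lt_max alpha_gt0 orbT.
have a22 : a2 < 2 * alpha by rewrite gt_max; apply/andP; split; lra.
have a2g : - a2 <= gamma by rewrite lerNl le_max lexx.
have al0 : 0 < 2 * alpha by rewrite mulr_gt0.
have [C1 C10 HC1] := @riesz_potential_min_powers_bounded R n (2 * alpha) a1 a2
  a20 a22 ltac:(rewrite /a1; lra) ltac:(rewrite /a1; lra).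
have [C2 C20 HC2] := @riesz_potential_power_le R n (2 * alpha) a1
  al0 ltac:(rewrite /a1; lra) ltac:(rewrite /a1; lra).
have [CG CG0 HCG] := @green_kernel_le R n alpha alpha_gt0 alpha_lt1 n_gt.
pose m (y : 'rV[R]_n) := Num.min (enorm y `^ (- a1)) (enorm y `^ (- a2)).
have m0 y : 0 <= m y by rewrite le_min !powR_ge0.
have HW x : (\int[leb]_y (enorm (x - y) `^ (- (n%:R - 2 * alpha)) * m y)%:E <=
    ((C1 + C2) * cutoff b x)%:E)%E.
  rewrite /cutoff; have [x1|x1] := leP (enorm x) 1.
    apply: le_trans (HC1 x) _; rewrite lee_fin powR1 mulr1; lra.
  have x0 : 0 < enorm x by exact: lt_trans x1.
  apply: (@le_trans _ _ (C2 * enorm x `^ (2 * alpha - a1))%:E).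
    apply: le_trans (HC2 x x0); apply: ge0_integral_mono => y _.
      by rewrite lee_fin mulr_ge0 ?powR_ge0.
    by rewrite lee_fin ler_wpM2l ?powR_ge0// ge_min lexx.
  rewrite lee_fin (_ : 2 * alpha - a1 = - b); last by rewrite /a1; ring.
  by rewrite ler_wpM2r ?powR_ge0//; lra.
pose D := CG * (C1 + C2).
have D0 : 0 <= D by rewrite mulr_ge0// addr_ge0.
have D1 : 0 < D + 1 by lra.
(* D collects the constants: e must satisfy e^q D <= e. *)
pose e := (D + 1) `^ (- (q - 1)^-1).
have e0 : 0 < e by rewrite powR_gt0.
have eq : e `^ q * D <= e.
  have -> : e `^ q = e * (D + 1)^-1.
    rewrite -[LHS]mulr1 -{1}(subrK 1 q) -gt0_powRD// powRr1 ?(ltW e0)// mulr1 mulrC.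
    by rewrite /e -powRrM mulNr mulVf ?gt_eqF// powR_inv1// ltW.
  by rewrite -mulrA ler_piMr ?(ltW e0)// mulrC ler_pdivrMr// mul1r lerDl.
exists (fun x => e * cutoff b x); split.
- by move=> x; rewrite mulr_gt0// powR_gt0// max1_gt0.
- apply: continuous_lower_semicontinuous => x.
  apply: (@continuous_comp _ _ _ (cutoff b) (fun t => e * t)).
    exact: continuous_cutoff.
  exact: mulrl_continuous.
move=> x; pose N := [set 0] `|` [set x] : set 'rV[R]_n.
have mN : measurable N by apply: measurableU; exact: measurable_rV_set1.
have N0 : leb N = 0%E.
  apply: null_set_setU; first exact: measurable_rV_set1.
  - exact: measurable_rV_set1.
  - exact: lebesgue_rV_set1.
  - exact: lebesgue_rV_set1.
apply: (@le_trans _ _ (\int[leb]_y ((CG * e `^ q)%:E *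
    (enorm (x - y) `^ (- (n%:R - 2 * alpha)) * m y)%:E))%E).
  apply: (ge0_integral_mono_negligible _ _ _ _ _ _ mN N0) => y.
  - apply: mule_ge0; last by rewrite lee_fin powR_ge0.
    apply: mule_ge0; last by rewrite lee_fin powR_ge0.
    exact: green_kernel_ge0.
  - by rewrite -EFinM lee_fin !mulr_ge0 ?powR_ge0.
  move=> Ny; have y0 : y != 0 by apply/eqP => y0; apply: Ny; left.
  have xy : x != y by apply/eqP => xy; apply: Ny; right.
  have ny0 : 0 < enorm y by rewrite -[y]subr0 enorm_subr_gt0.
  have le_m : (e * cutoff b y) `^ q * enorm y `^ gamma <= e `^ q * m y.
    rewrite powRM ?(ltW e0) ?powR_ge0// -mulrA ler_wpM2l ?powR_ge0//.
    rewrite /cutoff -powRrM mulNr; apply: cutoff_power_le => //.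
    - by rewrite mulr_ge0 ?(ltW b0)//; lra.
    - by rewrite /a1; lra.
  rewrite -muleA -EFinM.
  apply: (@le_trans _ _ ((CG * enorm (x - y) `^ (- (n%:R - 2 * alpha)))%:E *
     ((e * cutoff b y) `^ q * enorm y `^ gamma)%:E)%E).
    by rewrite lee_wpmul2r ?lee_fin ?mulr_ge0 ?powR_ge0// HCG.
  rewrite -!EFinM lee_fin.
  have -> : CG * e `^ q * (enorm (x - y) `^ (- (n%:R - 2 * alpha)) * m y) =
    CG * enorm (x - y) `^ (- (n%:R - 2 * alpha)) * (e `^ q * m y) by ring.
  by rewrite ler_wpM2l ?mulr_ge0 ?powR_ge0.
rewrite ge0_integralZl_EFin//; last 3 first.
- by move=> y _; rewrite lee_fin mulr_ge0 ?powR_ge0.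
- apply/measurable_EFinP; apply: measurable_funM.
    apply: (measurableT_comp (measurable_powR _)).
    by apply: measurable_enorm; exact: measurable_subr_rV.
  exact: (measurable_minr (measurable_enorm_powR _) (measurable_enorm_powR _)).
- by rewrite mulr_ge0 ?powR_ge0.
apply: (@le_trans _ _ ((CG * e `^ q)%:E * ((C1 + C2) * cutoff b x)%:E)%E).
  by rewrite lee_wpmul2l ?lee_fin ?mulr_ge0 ?powR_ge0.
rewrite -EFinM lee_fin.
have -> : CG * e `^ q * ((C1 + C2) * cutoff b x) = e `^ q * D * cutoff b x.
  by rewrite /D; ring.
by rewrite ler_wpM2r// powR_ge0.
Qed.

End existence.

(** * Critical and subcritical exponents: nonexistence *)

Section nonexistence.
Context {R : realType}.

(** The increments are at least c F(0)^q > 0, so F grows linearly; but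
c F(k+1)^q <= F(k+1) bounds F, as q > 1. *)
Lemma no_superlinear_growth (F : nat -> R) (c q : R) : 0 < c -> 1 < q -> 0 < F 0%N ->
  (forall k, F k + c * F k.+1 `^ q <= F k.+1) -> False.
Proof.
move=> c0 q1 F0 HF; have q10 : 0 < q - 1 by lra.
have F_gt0 k : F 0%N <= F k.
  elim: k => // k /le_trans; apply; apply: le_trans (HF k).
  by rewrite lerDl mulr_ge0 ?powR_ge0 ?(ltW c0).
have Fk0 k : 0 < F k by exact: lt_le_trans (F_gt0 k).
pose d := c * F 0%N `^ q; have d0 : 0 < d by rewrite mulr_gt0 ?powR_gt0.
have Fd k : d * k%:R <= F k.
  elim: k => [|k IH]; first by rewrite mulr0 ltW.
  apply: le_trans (HF k); rewrite -natr1 mulrDr mulr1 lerD// ler_wpM2l ?(ltW c0)//.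
  by apply: ge0_ler_powR; rewrite ?nnegrE ?(ltW F0) ?(ltW (Fk0 _))//; lra.
pose M := (c^-1) `^ (q - 1)^-1.
have FM k : F k.+1 <= M.
  have : c * F k.+1 `^ q <= F k.+1.
    by apply: le_trans (HF k); rewrite lerDr ltW.
  rewrite -{1}(subrK 1 q) -gt0_powRD// powRr1 ?(ltW (Fk0 _))// mulrA.
  rewrite -[leRHS]mul1r ler_pM2r// -ler_pdivlMl// mulr1 => h.
  have -> : F k.+1 = (F k.+1 `^ (q - 1)) `^ (q - 1)^-1.
    by rewrite -powRrM mulfV ?gt_eqF// powRr1// ltW.
  by apply: ge0_ler_powR; rewrite ?nnegrE ?powR_ge0 ?invr_ge0 ?(ltW q10) ?(ltW c0).
have M0 : 0 <= M by exact: powR_ge0.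
have := @archi_boundP R (M / d) (divr_ge0 M0 (ltW d0)).
rewrite ltr_pdivrMr// mulrC; apply/negP; rewrite -leNgt.
set k := Num.bound _; apply: le_trans (FM k); apply: le_trans (Fd k.+1).
by rewrite ler_wpM2l ?(ltW d0)// ler_nat.
Qed.

Context (n : nat).
Notation leb := (@lebesgue_rV R n).

Definition cube (d : R) : set 'rV[R]_n :=
  [set v | forall i, `[- d, d]%classic (v ord0 i)].

(** It replaces a dyadic annulus: a box whose points have norm of order d, and
which lies in the cube of half-side 2 d but outside the one of half-side d. *)
Definition corner (d : R) : set 'rV[R]_n :=
  [set v | forall i, `]d, (2 * d)]%classic (v ord0 i)].

Lemma measurable_cube d : measurable (cube d).
Proof. exact: (@measurable_rV_box R n (fun=> `[- d, d]%classic)). Qed.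

Lemma measurable_corner d : measurable (corner d).
Proof. exact: (@measurable_rV_box R n (fun=> `]d, (2 * d)]%classic)). Qed.

Lemma lebesgue_rV_corner d : 0 < d -> leb (corner d) = (d ^+ n)%:E.
Proof.
move=> d0; rewrite (@lebesgue_rV_box R n (fun=> `]d, (2 * d)]%classic))//.
under eq_bigr => i _.
  rewrite lebesgue_measure_itv/= lte_fin ifT; last by lra.
  rewrite -EFinB (_ : _ - _ = d); last by ring.
  over.
by rewrite prodEFin prodr_const card_ord.
Qed.

Lemma cube_enorm_le d x y : 0 < d -> cube d x -> cube d y ->
  enorm (x - y) <= 2 * Num.sqrt n%:R * d.
Proof.
move=> d0 xd yd; rewrite mulrAC [leRHS]mulrC.
apply: enorm_le => [|i]; first by rewrite mulr_ge0// ltW.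
have := xd i; have := yd i; rewrite /= !in_itv/= !mxE ler_norml => /andP[] + + /andP[].
lra.
Qed.

Lemma corner_sub_cube d : 0 < d -> corner d `<=` cube (2 * d).
Proof.
move=> d0 y yd i; have := yd i; rewrite /= !in_itv/= => /andP[dy ->].
by rewrite andbT; lra.
Qed.

Lemma cube_le d e : d <= e -> cube d `<=` cube e.
Proof.
move=> de y yd i; have := yd i; rewrite /= !in_itv/= => /andP[dy yd'].
by apply/andP; split; lra.
Qed.

Lemma corner_enorm_ge d y : (0 < n)%N -> 0 < d -> corner d y -> d <= enorm y.
Proof.
move=> n0 d0 /(_ (Ordinal n0)); rewrite /= in_itv/= => /andP[dy _].
apply: le_trans (coord_le_enorm y (Ordinal n0)); rewrite ger0_norm; first exact: ltW.
exact/ltW/(lt_trans d0).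
Qed.

Lemma corner_enorm_le d y : 0 < d -> corner d y -> enorm y <= 2 * Num.sqrt n%:R * d.
Proof.
move=> d0 yd; rewrite mulrAC [leRHS]mulrC; apply: enorm_le => [|i].
  by rewrite mulr_ge0// ltW.
have := yd i; rewrite /= in_itv/= => /andP[dy yd']; rewrite ger0_norm//.
exact/ltW/(lt_trans d0).
Qed.

(** Both bounds on |y| are needed, according to the sign of g. *)
Lemma corner_enorm_powR_ge (g : R) : (0 < n)%N -> exists2 c : R, 0 < c &
  forall d y, 0 < d -> corner d y -> c * d `^ g <= enorm y `^ g.
Proof.
move=> n0; pose K : R := 2 * Num.sqrt n%:R.
have K0 : 0 < K by rewrite mulr_gt0// sqrtr_gt0 ltr0n.
have [g0|g0] := leP 0 g.
  exists 1 => // d y d0 yd; rewrite mul1r.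
  apply: ge0_ler_powR => //; rewrite ?nnegrE ?enorm_ge0 ?(ltW d0)//.
  exact: corner_enorm_ge.
exists (K `^ g); first exact: powR_gt0.
move=> d y d0 yd; rewrite -powRM ?(ltW K0) ?(ltW d0)// -[g]opprK.
apply: powRN_le; first by rewrite oppr_ge0 ltW.
- exact: lt_le_trans (corner_enorm_ge _ _ n0 d0 yd).
- exact: corner_enorm_le.
Qed.

(** The mass of u^q |y|^gamma on dyadic cubes satisfies the recurrence of
no_superlinear_growth when the exponent is at most critical. *)
Lemma supersolution_exponent_gt (alpha gamma q : R) (u : 'rV[R]_n -> R) :
  0 < alpha -> alpha < 1 -> 2 * alpha < n%:R -> 1 < q ->
  (forall x, 0 < u x) -> lower_semicontinuous (EFin \o u) ->
  supersolution alpha gamma q u ->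
  (n%:R + gamma) / (n%:R - 2 * alpha) < q.
Proof.
move=> alpha_gt0 alpha_lt1 n_gt q1 u0 lscu supu.
have n0 : (0 < n)%N.
  by rewrite -(ltr0n R); apply: lt_trans n_gt; rewrite mulr_gt0.
have n2 : 0 < n%:R - 2 * alpha by lra.
have q0 : 0 < q by lra.
rewrite ltNge; apply/negP; rewrite ler_pdivlMr// => crit.
have mu_u : measurable_fun setT u.
  by apply/measurable_EFinP; exact: lower_semicontinuous_measurable_rV.
pose w y : R := u y `^ q * enorm y `^ gamma.
have w0 y : 0 <= w y by rewrite mulr_ge0 ?powR_ge0.
have mw : measurable_fun setT w.
  apply: measurable_funM; last exact: measurable_enorm_powR.
  exact: (measurableT_comp (measurable_powR _) mu_u).
have mwE (D : set 'rV[R]_n) : measurable_fun D (EFin \o w).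
  by apply/measurable_EFinP; exact: measurable_funTS.
have [cG cG0 HG] := @green_kernel_ge R n alpha alpha_gt0 alpha_lt1.
have [c2 c20 Hc2] := corner_enorm_powR_ge gamma n0.
pose K : R := 2 * Num.sqrt n%:R.
have K0 : 0 < K by rewrite mulr_gt0// sqrtr_gt0 ltr0n.
pose c1 := cG * K `^ (2 * alpha - n%:R).
have c10 : 0 < c1 by rewrite mulr_gt0 ?powR_gt0.
pose mass d : \bar R := (\int[leb]_(y in cube d) (w y)%:E)%E.
have mass0 d : (0 <= mass d)%E.
  by apply: integral_ge0 => y _; rewrite lee_fin.
have u_ge d x : 0 < d -> cube d x ->
    ((c1 * d `^ (2 * alpha - n%:R))%:E * mass d <= (u x)%:E)%E.
  move=> d0 xd; apply: le_trans (supu x).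
  have cd0 : 0 <= c1 * d `^ (2 * alpha - n%:R).
    by rewrite mulr_ge0 ?powR_ge0 ?(ltW c10).
  rewrite -ge0_integralZl_EFin//; last 2 first.
  - exact: measurable_cube.
  - by move=> y _; rewrite lee_fin.
  have G0 y : (0 <= green_kernel alpha x y)%E by exact: green_kernel_ge0.
  apply: ge0_integral_mono_subset => // y.
  - by move=> _; rewrite -EFinM lee_fin mulr_ge0.
  - by move=> _; rewrite -muleA -EFinM; apply: mule_ge0; [exact: G0|exact: w0].
  move=> yd; rewrite -[leRHS]muleA -[X in (_ <= _ * X)%E]EFinM.
  rewrite lee_wpmul2r ?lee_fin//.
  rewrite /c1 -mulrA -powRM ?(ltW K0) ?(ltW d0)//.
  by apply: HG; [rewrite mulr_gt0|exact: cube_enorm_le].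
clearbody c1.
(* u 0 is a real number. *)
have massoo d : 0 < d -> mass d \is a fin_num.
  move=> d0; rewrite ge0_fin_numE//; have c'0 : 0 < c1 * d `^ (2 * alpha - n%:R).
    by rewrite mulr_gt0 ?powR_gt0.
  have /(u_ge d 0 d0) : cube d 0.
    by move=> i; rewrite /= mxE in_itv/= oppr_le0 ltW.
  case: (mass d) => [r _| |]; first exact: ltry.
  - by rewrite mulry gtr0_sg// mul1e leNgt ltry.
  - by rewrite ltNye.
pose F d := fine (mass d).
have FE d : 0 < d -> mass d = (F d)%:E by move=> d0; rewrite fineK ?massoo.
have F0 d : 0 <= F d by exact: fine_ge0.
have mass_double d : 0 < d ->
    (mass d + \int[leb]_(y in corner d) (w y)%:E <= mass (2 * d)%R)%E.
  move=> d0; rewrite -ge0_integral_setU//; last 4 first.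
  - exact: measurable_cube.
  - exact: measurable_corner.
  - by move=> y _; rewrite lee_fin.
  - apply/disj_setPS => y [/(_ (Ordinal n0)) + /(_ (Ordinal n0))].
    rewrite /= !in_itv/= => /andP[_ yd] /andP[dy _].
    by move: (le_lt_trans yd dy); rewrite ltxx.
  apply: ge0_subset_integral.
  - by apply: measurableU; [exact: measurable_cube|exact: measurable_corner].
  - exact: measurable_cube.
  - exact: mwE.
  - by move=> y _; rewrite lee_fin.
  - move=> y [|]; last exact: corner_sub_cube.
    by apply: cube_le; lra.
(* This is where the exponent being at most critical is used. *)
have expo_ge0 : 0 <= (2 * alpha - n%:R) * q + gamma + n%:R.
  have -> : (2 * alpha - n%:R) * q = - (q * (n%:R - 2 * alpha)) by ring.
  lra.
pose B := c1 * 2 `^ (2 * alpha - n%:R).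
have B0 : 0 < B by rewrite mulr_gt0 ?powR_gt0.
pose c := B `^ q * c2.
have c0 : 0 < c by rewrite mulr_gt0 ?powR_gt0.
have corner_ge d : 1 <= d ->
    ((c * F (2 * d) `^ q)%:E <= \int[leb]_(y in corner d) (w y)%:E)%E.
  move=> d1; have d0 : 0 < d by exact: lt_le_trans d1.
  have d20 : 0 < 2 * d by rewrite mulr_gt0.
  pose L := c1 * (2 * d) `^ (2 * alpha - n%:R) * F (2 * d).
  have L0 : 0 <= L.
    by rewrite /L mulr_ge0 ?F0// mulr_ge0 ?powR_ge0 ?(ltW c10).
  apply: (@le_trans _ _ ((L `^ q * (c2 * d `^ gamma))%:E * leb (corner d))%E).
    rewrite lebesgue_rV_corner// -EFinM lee_fin.
    have -> : L = B * (d `^ (2 * alpha - n%:R) * F (2 * d)).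
      by rewrite /L /B powRM ?(ltW d0)//; ring.
    rewrite (@powRM _ B) ?(ltW B0) ?mulr_ge0 ?powR_ge0//.
    rewrite (@powRM _ (d `^ _)) ?powR_ge0// -powRrM -(powR_mulrn _ (ltW d0)) /c.
    set A := B `^ q; set Fq := F _ `^ q.
    have -> : A * (d `^ ((2 * alpha - n%:R) * q) * Fq) * (c2 * d `^ gamma) * d `^ n%:R =
      A * c2 * Fq * (d `^ ((2 * alpha - n%:R) * q) * d `^ gamma * d `^ n%:R) by ring.
    rewrite !gt0_powRD// ler_peMr ?mulr_ge0 ?powR_ge0 ?(ltW c20)//.
    by rewrite -[leLHS](powRr0 d) ler_powR.
  apply: integral_ge_cst => //.
  - exact: measurable_corner.
  - by rewrite mulr_ge0 ?mulr_ge0 ?powR_ge0 ?(ltW c20).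
  - by move=> y _; rewrite lee_fin.
  move=> y yd; rewrite lee_fin /w ler_pM ?mulr_ge0 ?powR_ge0 ?(ltW c20) ?Hc2//.
  apply: ge0_ler_powR; rewrite ?nnegrE ?(ltW q0) ?L0 ?(ltW (u0 y))//.
  rewrite -lee_fin /L EFinM -FE//; apply: u_ge => //.
  exact: corner_sub_cube.
(* If the integral vanished, w would vanish almost everywhere on a box of
   positive measure. *)
have corner_gt0 d : 0 < d -> (0 < \int[leb]_(y in corner d) (w y)%:E)%E.
  move=> d0; rewrite lt_neqAle integral_ge0 ?andbT; last first.
    by move=> y _; rewrite lee_fin.
  apply/eqP => /esym w_eq0.
  have : (\int[leb]_(y in corner d) `|(w y)%:E| = 0)%E.
    by under eq_integral do rewrite gee0_abs ?lee_fin//.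
  move/(ae_eq_integral_abs leb (measurable_corner d) (mwE _)).1 => [N [mN N0 wN]].
  have : (leb (corner d) <= leb N)%E.
    apply: le_measure; rewrite ?inE//; first exact: measurable_corner.
    move=> y yd; apply: wN => /= /(_ yd)[] /eqP; apply/negP.
    rewrite gt_eqF// mulr_gt0 ?powR_gt0//.
    exact: lt_le_trans (corner_enorm_ge _ _ n0 d0 yd).
  by rewrite N0 lebesgue_rV_corner// leNgt lte_fin exprn_gt0.
(* The sequence starts at d = 2, whose cube contains the corner of size 1. *)
have pow2 k : 1 <= 2 ^+ k.+1 :> R by rewrite exprn_ege1// ler1n.
have pow20 k : 0 < 2 ^+ k.+1 :> R by rewrite exprn_gt0.
apply: (@no_superlinear_growth (fun k => F (2 ^+ k.+1)) c q) => //.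
  rewrite -lte_fin -FE//; apply: lt_le_trans (corner_gt0 1 ltr01) _.
  by rewrite expr1 -[2]mulr1; apply: le_trans (mass_double 1 ltr01); rewrite leeDr.
move=> k; rewrite [2 ^+ k.+2]exprS -lee_fin EFinD -!FE ?mulr_gt0//.
by apply: le_trans (mass_double _ (pow20 k)); rewrite leeD2l// corner_ge.
Qed.

End nonexistence.

Theorem corollary1p6 (R : realType) (n : nat) (alpha gamma q : R)
    (alpha_gt0 : 0 < alpha) (alpha_lt1 : alpha < 1)
    (n_gt : 2 * alpha < n%:R) (gamma_gt : - (2 * alpha) < gamma)
    (q_gt1 : 1 < q) :
  (exists u : 'rV[R]_n -> R,
     [/\ forall x, 0 < u x,
         lower_semicontinuous (EFin \o u) &
         supersolution alpha gamma q u]) <->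
  (n%:R + gamma) / (n%:R - 2 * alpha) < q.
Proof.
split=> [[u [u0 lscu supu]]|q_gt]; first exact: supersolution_exponent_gt supu.
exact: supersolution_exists.
Qed.
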